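(* Let $a>1$, let $\Psi=\{\psi_1,\psi_2,\dots,\psi_L\}$ be a finite subset of $L^2(\mathbb{R}_+)$ with cardinality $L$, and let $0<A\le B<\infty$. Then $\mathcal{MD}(\Psi,a)$ is a frame for $L^2(\mathbb{R}_+)$ with frame bounds $A$ and $B$ if and only if $$A\le\sum_{l=1}^{L}\left|\Theta_a\psi_l(x,\xi)\right|^2\le B\quad\text{for a.e. }(x,\xi)\in[1,a)\times[0,1).$$
   Context: $\mathbb{R}_+=(0,\infty)$, and $L^2(\mathbb{R}_+)$ is the space of complex-valued square-integrable functions on $\mathbb{R}_+$. A measurable function $h$ on $\mathbb{R}_+$ is $a$-dilation periodic if $h(ax)=h(x)$ for a.e. $x\in\mathbb{R}_+$. For $m\in\mathbb{Z}$, $\Lambda_m$ is the $a$-dilation periodic function on $\mathbb{R}_+$ determined by $\Lambda_m(x)=\frac{1}{\sqrt{a-1}}e^{\frac{2\pi i m x}{a-1}}$ for $x\in[1,a)$. For $c>0$, $D_c f(x)=\sqrt{c}\,f(cx)$. The dilation-and-modulation system is $\mathcal{MD}(\Psi,a)=\{\Lambda_m D_{a^j}\psi_l:\ m,j\in\mathbb{Z},\ 1\le l\le L\}$ (indexed by $(m,j,l)$). The $\Theta_a$-transform of $f\in L^2(\mathbb{R}_+)$ is $\Theta_a f(x,\xi)=\sum_{l\in\mathbb{Z}}a^{l/2}f(a^l x)e^{-2\pi i l\xi}$ for a.e. $(x,\xi)\in\mathbb{R}_+\times\mathbb{R}$ (for a.e. $x$ the coefficient sequence is in $\ell^2(\mathbb{Z})$,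 so the series is a Fourier series converging in $L^2([0,1))$ in $\xi$). $\mathcal{MD}(\Psi,a)$ is a frame for $L^2(\mathbb{R}_+)$ with frame bounds $A$ and $B$ if $A\|f\|_{L^2(\mathbb{R}_+)}^2\le\sum_{l=1}^{L}\sum_{m,j\in\mathbb{Z}}|\langle f,\Lambda_m D_{a^j}\psi_l\rangle_{L^2(\mathbb{R}_+)}|^2\le B\|f\|_{L^2(\mathbb{R}_+)}^2$ for all $f\in L^2(\mathbb{R}_+)$; the bounds are not required to be optimal. *)

(* Defs.v *)
From HB Require Import structures.
From mathcomp Require Import all_boot all_order all_algebra.
From mathcomp Require Import all_classical all_reals all_analysis.
From mathcomp Require Import complex.

Set Implicit Arguments.
Unset Strict Implicit.
Unset Printing Implicit Defensive.

Import Order.TTheory GRing.Theory Num.Theory.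
Import numFieldNormedType.Exports.

Local Open Scope classical_set_scope.
Local Open Scope ring_scope.
Local Open Scope complex_scope.

Section ComplexFunctions.
Context (R : realType).

Definition Rpos : set R := `]0, +oo[.

Definition sqnormc (z : R[i]) : R := ComplexField.Normc.normc z ^+ 2.

Definition expiR (t : R) : R[i] := cos t +i* sin t.

Definition cmeasurable_fun d (T : measurableType d) (D : set T)
    (f : T -> R[i]) : Prop :=
  measurable_fun D (fun x => complex.Re (f x)) /\
  measurable_fun D (fun x => complex.Im (f x)).

Definition cintegral d (T : measurableType d)
    (mu : {measure set T -> \bar R}) (D : set T) (f : T -> R[i]) : R[i] :=
  (\int[mu]_(x in D) complex.Re (f x)) +i*
  (\int[mu]_(x in D) complex.Im (f x)).

Definition sqnormL2 (D : set R) (f : R -> R[i]) : \bar R :=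
  (\int[lebesgue_measure]_(x in D) (sqnormc (f x))%:E)%E.

(* Elements of L^2 are handled as functions; equality in L^2 is [eqL2]. *)
Definition inL2 (D : set R) (f : R -> R[i]) : Prop :=
  cmeasurable_fun D f /\ (sqnormL2 D f < +oo)%E.

Definition eqL2 (D : set R) (f g : R -> R[i]) : Prop :=
  {ae lebesgue_measure, forall x : R, D x -> f x = g x}.

Definition innerL2 (D : set R) (f g : R -> R[i]) : R[i] :=
  cintegral lebesgue_measure D (fun x => f x * (g x)^*).

End ComplexFunctions.

Section DilationModulation.
Context (R : realType).
Implicit Types (a c x xi : R) (f g : R -> R[i]).

Definition dilation c f : R -> R[i] :=
  fun x => (Num.sqrt c)%:C * f (c * x).

Definition dilation_periodic a f : Prop :=
  {ae lebesgue_measure, forall x : R, Rpos x -> f (a * x) = f x}.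

(* The a-dilation periodic extension to (0, oo) of the restriction of g to
   [1, a): for x > 0, floor (log_a x) is the unique integer k such that
   x / a ^ k belongs to [1, a). *)
Definition dilation_periodize a g : R -> R[i] :=
  fun x => g (x / a ^ Num.floor (ln x / ln a)).

Lemma dilation_periodizeM a g x : 1 < a -> 0 < x ->
  dilation_periodize a g (a * x) = dilation_periodize a g x.
Proof.
move=> a1 x0; have a0 : 0 < a by apply: lt_trans a1.
have lna : ln a != 0 by rewrite gt_eqF// ln_gt0.
rewrite /dilation_periodize lnM ?posrE// mulrDl divff//.
have -> : Num.floor (1 + ln x / ln a) = 1 + Num.floor (ln x / ln a).
  apply: floor_def; have /andP[ge_fl lt_fl] := floor_itv (ln x / ln a).
  by rewrite -addrA !(intrD _ 1) lerD2l ge_fl ltrD2l.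
rewrite expfzDr ?gt_eqF// expr1z.
by rewrite -mulf_div divff ?gt_eqF// mul1r.
Qed.

Lemma dilation_periodic_periodize a g : 1 < a ->
  dilation_periodic a (dilation_periodize a g).
Proof.
move=> a1; apply: aeW => x; rewrite /Rpos /= in_itv/= andbT => x0.
exact: dilation_periodizeM.
Qed.

Lemma dilation_periodizeE a g x : 1 < a -> 1 <= x < a ->
  dilation_periodize a g x = g x.
Proof.
move=> a1 /andP[x1 xa]; have lna0 : 0 < ln a by rewrite ln_gt0.
have x0 : 0 < x by apply: lt_le_trans x1.
rewrite /dilation_periodize (_ : Num.floor _ = 0) ?expr0z ?divr1//.
apply: floor_def; apply/andP; split.
  by rewrite divr_ge0 ?ln_ge0// ltW.
by rewrite add0r ltr_pdivrMr// mul1r ltr_ln// posrE (lt_trans x0).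
Qed.

Definition Lambda a (m : int) : R -> R[i] :=
  dilation_periodize a (fun x =>
    ((Num.sqrt (a - 1))^-1)%:C * expiR (2 * pi * m%:~R * x / (a - 1))).

Definition MD (L : nat) (psi : 'I_L -> R -> R[i]) a
    (l : 'I_L) (m j : int) : R -> R[i] :=
  fun x => Lambda a m x * dilation (a ^ j) (psi l) x.

Definition is_MD_frame (L : nat) (psi : 'I_L -> R -> R[i]) (a A B : R) : Prop :=
  forall f, inL2 (@Rpos R) f ->
    let S : \bar R := (\sum_(l < L) \esum_(mj in [set: int * int])
      (sqnormc (innerL2 (@Rpos R) f (MD psi a l mj.1 mj.2)))%:E)%E in
    (A%:E * sqnormL2 (@Rpos R) f <= S /\ S <= B%:E * sqnormL2 (@Rpos R) f)%E.

Definition Theta_term a f (x xi : R) (l : int) : R[i] :=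
  (a `^ (l%:~R / 2))%:C * f (a ^ l * x) * expiR (- (2 * pi * l%:~R * xi)).

(* The symmetric partial sum over -n <= l <= n. *)
Definition Theta_psum a f (n : nat) (x xi : R) : R[i] :=
  \sum_(k < n.*2.+1) Theta_term a f x xi (k%:Z - n%:Z).

Definition plane := (measurableTypeR R * measurableTypeR R)%type.

Definition leb2 : {measure set plane -> \bar R} :=
  (@lebesgue_measure R \x @lebesgue_measure R)%E.

(* F is a jointly measurable representative, on (0, oo) x R, of the function
   whose slice at a.e. x is the sum of the Fourier series. Without joint
   measurability the slices would not determine F up to a product-null set. *)
Definition is_Theta a f (F : plane -> R[i]) : Prop :=
  [/\ cmeasurable_fun (@Rpos R `*` setT) F,
      {ae lebesgue_measure, forall x : R, Rpos x ->
        (fun n => sqnormL2 `[0, 1[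
           (fun xi => Theta_psum a f n x xi - F (x, xi))) @ \oo --> 0%E}
    & {ae leb2, forall p : plane, Rpos p.1 -> F (p.1, p.2 + 1) = F p}].

(* is_Theta a f determines F up to a null set; for a > 1 and f in L^2(0, oo)
   such an F exists, so the default value 0 is not used. *)
Definition Theta a f : plane -> R[i] := xget (fun=> 0) (is_Theta a f).

End DilationModulation.

(* Main.v *)
Require Import Defs.
From mathcomp Require Import all_boot all_order all_algebra.
From mathcomp Require Import all_classical all_reals all_analysis.
From mathcomp Require Import measurable_realfun complex.
From mathcomp Require Import ring lra zify.

(** Write J = [1, a), I = [0, 1) and Q = J x I. The proof diagonalises the
    system. For x in J the numbers a^(k/2) f (a^k x) are the Fourier coefficients
    of the slice Theta f (x, .), and the intervals a^k J tile the half-line; so Parseval in xi and the rescaling of each tile to J give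
    |f|^2 = iint_Q |Theta f|^2 ([Zak_isometry]). By polarisation the transform
    also preserves inner products ([Zak_inner]).

    Under the transform the dilation by a^j becomes multiplication by
    e^(2 pi i j xi), and Lambda_m, being invariant under dilation by a, becomes
    multiplication by its restriction to J ([Zak_atom]). Consequently
    <f, Lambda_m D_(a^j) psi> is a double Fourier coefficient on Q of the
    function H = Theta f * conj (Theta psi). The functions
    Lambda_m(x) e^(2 pi i j xi) form an orthonormal basis of L^2(Q), so the sum
    of the squared coefficients is iint_Q |Theta f|^2 |Theta psi|^2
    ([frame_sum]). Here H is only integrable, as a product of two square
    integrable functions, and both sides may be infinite; this is why Parseval
    ([parseval], [parseval_strip]) is proved for integrable functions, which
    rests on the uniqueness of Fourier coefficients in L^1 ([fcoef_eq0]).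

    Summing over l, the frame inequality reads
    A iint |F|^2 <= iint |F|^2 W <= B iint |F|^2 with F = Theta f and
    W = sum_l |Theta psi_l|^2. Bounds on W give it by integration
    ([frame_of_bounds]). Conversely every function in L^2(Q) is the transform
    of some f ([Zak_surjective]); the indicators of {W < A} and {W > B} then
    show that these sets are null ([bounds_of_frame]).

    A separate point is that a jointly measurable representative of Theta f
    exists at all. Partial sums taken along a subsequence that depends
    measurably on the coefficients converge almost everywhere, and their
    pointwise limit is jointly measurable ([fsum], [measurable_fsum_joint],
    [Theta_spec]).

    Uniqueness in L^1 is obtained by smoothing with the trigonometric kernel
    ((1 + cos (2 pi t)) / 2)^n: a function orthogonal to all cosines and sines is
    orthogonal to the smoothed indicator of [0, v), hence in the limit to the
    indicator itself, so its primitive vanishes ([ae_eq0_of_coeffs]). *)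

Set Implicit Arguments.
Unset Strict Implicit.
Unset Printing Implicit Defensive.

Import Order.TTheory GRing.Theory Num.Theory.
Import numFieldNormedType.Exports.

Local Open Scope classical_set_scope.
Local Open Scope complex_scope.
Local Open Scope ring_scope.

(** * Integrals over rectangles and almost everywhere statements *)

Section rectangles.
Context d1 d2 (T1 : measurableType d1) (T2 : measurableType d2) (R : realType).
Context (m1 : {sigma_finite_measure set T1 -> \bar R}).
Context (m2 : {sigma_finite_measure set T2 -> \bar R}).
Context (A : set T1) (B : set T2) (mA : measurable A) (mB : measurable B).

Let mAB : measurable (A `*` B) := measurableX mA mB.

Let restrict_section (f : T1 * T2 -> \bar R) x :
  (\int[m2]_y (f \_ (A `*` B)) (x, y) =
   ((fun x => \int[m2]_(y in B) f (x, y)) \_ A) x)%E.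
Proof.
rewrite [in RHS]/patch; case: ifPn => xA.
  rewrite [RHS]integral_mkcond; apply: eq_integral => y _.
  by rewrite /patch in_setX/= xA.
apply: integral0_eq => y _; rewrite /patch in_setX/= (negbTE xA).
by [].
Qed.

(** Extending f by zero reduces the rectangle to the whole product: a section of
    the extension is the extension by zero of a section of f. *)
Lemma tonelli_rect (f : T1 * T2 -> \bar R) :
  measurable_fun (A `*` B : set (T1 * T2)%type) f -> (forall p, (A `*` B) p -> 0 <= f p)%E ->
  measurable_fun A (fun x => \int[m2]_(y in B) f (x, y))%E /\
  (\int[m1 \x m2]_(p in A `*` B) f p =
   \int[m1]_(x in A) \int[m2]_(y in B) f (x, y))%E.
Proof.
move=> mf f0.
have mg : measurable_fun setT (f \_ (A `*` B)).
  exact/(measurable_restrictT _ _).1.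
have g0 p : (0 <= (f \_ (A `*` B)) p)%E by apply: erestrict_ge0.
have mG := measurable_fun_fubini_tonelli_F (m2 := m2) _ mg g0.
split.
  apply/(measurable_restrictT _ _).2 => //.
  rewrite (_ : _ \_ _ = fubini_F m2 (f \_ (A `*` B)))//.
  by apply/funext => x; rewrite -restrict_section.
rewrite integral_mkcond fubini_tonelli1// [RHS]integral_mkcond.
by apply: eq_integral => x _; rewrite -restrict_section.
Qed.

(** The same extension by zero, for an integrand without sign. The inner integral
    is real-valued, and is the finite part of the extended one at the almost
    all x whose section is integrable. *)
Lemma fubini_rect (f : T1 * T2 -> R) :
  (m1 \x m2)%E.-integrable (A `*` B) (EFin \o f) ->
  [/\ {ae m1, forall x, A x -> m2.-integrable B (fun y => (f (x, y))%:E)},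
      m1.-integrable A (fun x => (\int[m2]_(y in B) f (x, y))%:E) &
      \int[(m1 \x m2)%E]_(p in A `*` B) f p =
      \int[m1]_(x in A) (\int[m2]_(y in B) f (x, y))].
Proof.
move=> fi.
have gi : (m1 \x m2)%E.-integrable setT ((EFin \o f) \_ (A `*` B)).
  by apply/integrable_restrict => //; rewrite setTI.
have ae1 := ae_integrable1 gi.
have aeB : {ae m1, forall x, A x -> m2.-integrable B (fun y => (f (x, y))%:E)}.
  apply: filterS ae1 => x xi Ax.
  have := xi; rewrite (_ : (fun y => _) = (fun y => (f (x, y))%:E) \_ B).
    by move=> h; have := (integrable_restrict m2 mB measurableT _).2 h; rewrite setTI.
  apply/funext => y; rewrite /patch in_setX/=.
  by rewrite (mem_set Ax).
have iF := integrable_fubini_F gi.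
have FE : fubini_F m2 ((EFin \o f) \_ (A `*` B)) =
  (fun x => \int[m2]_(y in B) (f (x, y))%:E)%E \_ A.
  by apply/funext => x; rewrite /fubini_F restrict_section.
have iA : m1.-integrable A (fun x => \int[m2]_(y in B) (f (x, y))%:E)%E.
  move: iF; rewrite FE.
  by move=> h; have := (integrable_restrict m1 mA measurableT _).2 h; rewrite setTI.
have aeE : ae_eq m1 A (fun x => \int[m2]_(y in B) (f (x, y))%:E)%E
    (fun x => (\int[m2]_(y in B) f (x, y))%:E).
  apply: filterS aeB => x xi Ax /=.
  by rewrite /Rintegral fineK//; apply: integrable_fin_num => //; exact: xi.
have iR : m1.-integrable A (fun x => (\int[m2]_(y in B) f (x, y))%:E).
  have mR : measurable_fun A (fun x => (\int[m2]_(y in B) f (x, y))%:E).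
    apply/measurable_EFinP; apply: (measurableT_comp (f := fine)) => //.
    exact: (measurable_int m1).
  apply/integrableP; split => //.
  rewrite (ae_eq_integral (fun x => `|\int[m2]_(y in B) (f (x, y))%:E|)%E)//.
  - by case/integrableP : iA.
  - exact: measurableT_comp.
  - by apply: measurableT_comp => //; exact: (measurable_int m1).
  - by apply: filterS aeE => x h Ax; have /= -> := h Ax.
split => //.
rewrite /Rintegral; congr fine.
rewrite integral_mkcond -integral12_prod_meas1// FE -integral_mkcond.
apply: ae_eq_integral => //.
- exact: (measurable_int m1).
- exact: (measurable_int m1).
Qed.

End rectangles.

Section almost_everywhere.
Context d (T : measurableType d) (R : realType).
Context (m : {measure set T -> \bar R}).
Implicit Types P Q : T -> Prop.

Lemma ae_imply P Q : (forall x, P x -> Q x) ->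
  {ae m, forall x, P x} -> {ae m, forall x, Q x}.
Proof. by move=> PQ; apply: filterS. Qed.

Lemma ae_imply2 P1 P2 Q : (forall x, P1 x -> P2 x -> Q x) ->
  {ae m, forall x, P1 x} -> {ae m, forall x, P2 x} -> {ae m, forall x, Q x}.
Proof. by move=> PQ; apply: filterS2. Qed.

Lemma ae_forall_int (P : int -> T -> Prop) :
  (forall k, {ae m, forall x, P k x}) -> {ae m, forall x, forall k, P k x}.
Proof.
move=> aeP; have h : {ae m, forall x, forall n : nat, P n%:Z x /\ P (- n%:Z) x}.
  by apply: ae_foralln => n; apply: ae_imply2 (aeP n%:Z) (aeP (- n%:Z)).
apply: ae_imply h => x h [n|n]; first exact: (h n).1.
by rewrite NegzE; exact: (h n.+1).2.
Qed.

End almost_everywhere.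

Section comparison.
Context d (T : measurableType d) (R : realType) (m : {measure set T -> \bar R}).

(** On the set E where the inequality fails, u - v is positive while its integral
    is at most 0, so E is null. Finiteness of the integral of v is what allows
    the subtraction. *)
Lemma ae_le_of_integral (D : set T) (u v : T -> R) : measurable D ->
  measurable_fun D u -> measurable_fun D v -> (forall x, D x -> 0 <= v x) ->
  let E := D `&` [set x | v x < u x] in
  (\int[m]_(x in E) (v x)%:E < +oo)%E ->
  (\int[m]_(x in E) (u x)%:E <= \int[m]_(x in E) (v x)%:E)%E ->
  {ae m, forall x, D x -> u x <= v x}.
Proof.
move=> mD mu mv v0 E vi le_uv.
have mE : measurable E.
  by have := measurable_fun_ltr mv mu mD (Y := [set true]); apply.
have ED : E `<=` D by move=> x [].
have mw : measurable_fun E (fun x => (u x - v x)%:E).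
  by apply/measurable_EFinP; apply: measurable_funB; exact: measurable_funS ED _.
have w0 x : E x -> (0 <= (u x - v x)%:E)%E.
  by move=> [_ /= vu]; rewrite lee_fin subr_ge0 ltW.
have mvE : measurable_fun E (fun x => (v x)%:E).
  by apply/measurable_EFinP; exact: measurable_funS ED _.
have v0E x : E x -> (0 <= (v x)%:E)%E by move=> /ED Dx; rewrite lee_fin v0.
have uE : (\int[m]_(x in E) (u x)%:E =
    \int[m]_(x in E) (u x - v x)%:E + \int[m]_(x in E) (v x)%:E)%E.
  rewrite -ge0_integralD//; apply: eq_integral => x _.
  by rewrite -EFinD subrK.
have vfin : (\int[m]_(x in E) (v x)%:E)%E \is a fin_num.
  by rewrite ge0_fin_numE// integral_ge0.
have w00 : (\int[m]_(x in E) `|(u x - v x)%:E| = 0)%E.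
  have -> : (\int[m]_(x in E) `|(u x - v x)%:E| = \int[m]_(x in E) (u x - v x)%:E)%E.
    by apply: eq_integral => x; rewrite inE => Ex; rewrite gee0_abs// w0.
  apply/eqP; rewrite eq_le; apply/andP; split; last exact: integral_ge0.
  by move: le_uv; rewrite uE -leeBrDr// subee.
have := (ae_eq_integral_abs m mE mw).1 w00.
apply: ae_imply => x h Dx; rewrite leNgt; apply/negP => vu.
have [/eqP] := h (conj Dx vu); rewrite subr_eq0 => /eqP uv.
by rewrite uv ltxx in vu.
Qed.

End comparison.

(** * A trigonometric kernel concentrating at the integers *)

Section peak_kernel.
Context {R : realType}.
Local Notation mu := (@lebesgue_measure R).
Implicit Types (t x y : R) (n : nat) (k : int).

(** A list of (coefficient, frequency) pairs rather than a coefficient function: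
    repeated and negative frequencies are harmless, so products need no
    normalisation. *)
Definition pcos (s : seq (R * int)) (t : R) : R :=
  \sum_(p <- s) p.1 * cos (2 * pi * p.2%:~R * t).

(** It takes values in [0, 1] and equals 1 exactly at the integers, so for large n
    its mass on a period sits near them. *)
Definition peak (n : nat) (t : R) : R := ((1 + cos (2 * pi * t)) / 2) ^+ n.

(** The product formula for cosines turns a factor (1 + cos (2 pi t)) / 2 into a
    combination of shifts of the frequencies by 0, 1 and -1. *)
Lemma peak_pcos n : exists s, forall t, peak n t = pcos s t.
Proof.
elim: n => [|n [s IH]].
  exists [:: (1, 0)] => t; rewrite /peak /pcos big_seq1 expr0.
  by rewrite mulr0 mul0r cos0 mulr1.
exists ([seq (p.1 / 2, p.2) | p <- s] ++ [seq (p.1 / 4, p.2 + 1) | p <- s]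
   ++ [seq (p.1 / 4, p.2 - 1) | p <- s]) => t.
rewrite /peak exprS -/(peak n t) IH /pcos !big_cat !big_map/= -!big_split/=.
rewrite mulr_sumr; apply: eq_bigr => p _.
rewrite !intrD mulrN1z.
rewrite [X in _ = _ + (_ * cos X + _ * cos _)](_ : _ =
  2 * pi * p.2%:~R * t + 2 * pi * t); last by ring.
rewrite [X in _ = _ + (_ + _ * cos X)](_ : _ =
  2 * pi * p.2%:~R * t - 2 * pi * t); last by ring.
by rewrite cosD cosB; field.
Qed.

Let base_ge0 t : 0 <= (1 + cos t) / 2.
Proof. by rewrite divr_ge0// addrC -lerBlDr sub0r cos_geN1. Qed.

Lemma peak_ge0 n t : 0 <= peak n t.
Proof. exact: exprn_ge0. Qed.

Lemma continuous_cos_affine (c d : R) : continuous (fun t => cos (c * t + d)).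
Proof.
move=> t; apply: continuous_comp; last exact: continuous_cos.
apply: cvgD; last exact: cvg_cst.
by apply: cvgM; [exact: cvg_cst|exact: cvg_id].
Qed.

Lemma continuous_sin_affine (c d : R) : continuous (fun t => sin (c * t + d)).
Proof.
move=> t; apply: continuous_comp; last exact: continuous_sin.
apply: cvgD; last exact: cvg_cst.
by apply: cvgM; [exact: cvg_cst|exact: cvg_id].
Qed.

Lemma cos2piZ k (d : R) : cos (2 * pi * k%:~R + d) = cos d.
Proof.
have H (n : nat) (e : R) : cos (e + 2 * pi * n%:R) = cos e.
  elim: n => [|n IH]; first by rewrite mulr0 addr0.
  by rewrite -[RHS]IH -[RHS]cosD2pi; congr cos; rewrite -natr1 -mulr_natl; ring.
case: k => n; first by rewrite addrC -pmulrn H.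
rewrite NegzE mulrNz -pmulrn -(H n.+1).
by congr cos; ring.
Qed.

Lemma sin2piZ k (d : R) : sin (2 * pi * k%:~R + d) = sin d.
Proof. by rewrite -!cosBpihalf -addrA cos2piZ. Qed.

Lemma continuous_integrable01 (f : R -> R) : continuous f ->
  mu.-integrable `[0, 1[ (EFin \o f).
Proof.
move=> cf; have : mu.-integrable `[0, 1] (EFin \o f).
  apply: continuous_compact_integrable; first exact: segment_compact.
  exact: continuous_subspaceT.
by apply: integrableS => // t /=; rewrite !in_itv/= => /andP[-> /ltW ->].
Qed.

(** The phase d makes the statement cover sines as well, at d = - pi / 2. *)
Lemma Rintegral_cos k (d : R) :
  \int[mu]_(t in `[0, 1[) cos (2 * pi * k%:~R * t + d) = (k == 0)%:R * cos d.
Proof.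
rewrite Rintegral_itv_bndo_bndc; last first.
  exact/continuous_integrable01/continuous_cos_affine.
have [->|k0] := eqVneq k 0.
  rewrite mul1r; under eq_Rintegral do rewrite mulr0 mul0r add0r.
  rewrite Rintegral_cst//= lebesgue_measure_itv/= lte01 oppr0 addr0/=.
  by rewrite mulr1.
set c := 2 * pi * k%:~R.
have c0 : c != 0 by rewrite !mulf_neq0// ?intr_eq0// gt_eqF// pi_gt0.
have dS t : is_derive t 1 (fun t => sin (c * t + d) / c) (cos (c * t + d)).
  have dl : is_derive t 1 (fun t => c * t + d) c.
    have -> : (fun t => c * t + d) = (c \*: (@id R)) + cst d by [].
    by apply: is_derive_eq; rewrite addr0 /GRing.scale/= mulr1.
  have -> : (fun t => sin (c * t + d) / c) = c^-1 \*: (sin \o (fun t => c * t + d)).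
    by apply/funext => u; rewrite mulrC.
  apply: is_derive_eq.
  by rewrite /GRing.scale/= mulrCA mulVf// mulr1.
rewrite mul0r /Rintegral (@continuous_FTC2 _ _ (fun t => sin (c * t + d) / c))//.
- rewrite mulr1 mulr0 add0r sin2piZ.
  by rewrite subee.
- exact/continuous_subspaceT/continuous_cos_affine.
- have cS : continuous (fun t => sin (c * t + d) / c).
    by move=> t; apply: cvgM; [exact: continuous_sin_affine|exact: cvg_cst].
  split.
  + by move=> t _; case: (dS t).
  + exact/cvg_at_right_filter/cS.
  + exact/cvg_at_left_filter/cS.
- move=> t _; rewrite derive1E; exact: derive_val.
Qed.

End peak_kernel.

(** * Uniqueness of Fourier coefficients of real integrable functions *)

Section uniqueness.
Context {R : realType}.
Local Notation mu := (@lebesgue_measure R).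
Implicit Types (t x y : R) (n : nat) (k : int).

Section measure_space.
Context d (T : measurableType d) (m : {measure set T -> \bar R}).
Context (D : set T) (mD : measurable D).

Lemma integrable_bounded_mul (g h : T -> R) (M : R) :
  m.-integrable D (EFin \o g) -> measurable_fun D h ->
  (forall z, D z -> `|h z| <= M) ->
  m.-integrable D (fun z => (g z * h z)%:E).
Proof.
move=> gi mh hM.
have gM : m.-integrable D (fun z => (M%:E * (EFin \o g) z)%E).
  exact: integrableZl.
apply: le_integrable gM => //.
  apply/measurable_EFinP; apply: measurable_funM => //.
  by apply/measurable_EFinP; exact: (measurable_int m).
move=> x Dx /=; rewrite lee_fin !normrM mulrC ler_wpM2r//.
by apply: (le_trans (hM x Dx)); exact: ler_norm.
Qed.

End measure_space.

Lemma integrable01_bounded_mul (h : R -> R) (J : set R) (M : R) : measurable J ->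
  J `<=` `[0, 1[ -> measurable_fun J h -> (forall x, J x -> `|h x| <= M) ->
  mu.-integrable J (EFin \o h).
Proof.
move=> mJ JI mh hM; apply: measurable_bounded_integrable => //.
  apply: (@le_lt_trans _ _ (mu `[0, 1[)); first by apply: le_measure; rewrite ?inE.
  by rewrite lebesgue_measure_itv/= lte01 oppr0 adde0 ltry.
exists M; split; first exact: num_real.
by move=> N MN x Jx; apply: le_trans (ltW MN); exact: hM.
Qed.

Variable g : R -> R.
Hypothesis ig : mu.-integrable `[0, 1[ (EFin \o g).
Hypothesis gcos : forall k,
  \int[mu]_(x in `[0, 1[) (g x * cos (2 * pi * k%:~R * x)) = 0.
Hypothesis gsin : forall k,
  \int[mu]_(x in `[0, 1[) (g x * sin (2 * pi * k%:~R * x)) = 0.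

(** Integrals are linear only on integrable functions; boundedness of h makes
    g * h integrable, so that these functions form a vector space. *)
Let orth (h : R -> R) := [/\ measurable_fun setT h, exists M, forall x, `|h x| <= M
  & \int[mu]_(x in `[0, 1[) (g x * h x) = 0].

Let orthI h : orth h -> mu.-integrable `[0, 1[ (fun x => (g x * h x)%:E).
Proof.
move=> [mh [M hM] _]; apply: (@integrable_bounded_mul _ _ _ _ _ _ _ M) => //.
exact: measurable_funTS.
Qed.

Let orthD h1 h2 : orth h1 -> orth h2 -> orth (fun x => h1 x + h2 x).
Proof.
move=> o1 o2; have i1 := orthI o1; have i2 := orthI o2.
case: o1 => [m1 [M1 b1] z1]; case: o2 => [m2 [M2 b2] z2]; split.
- exact: measurable_funD.
- exists (M1 + M2) => x; apply: le_trans (ler_normD _ _) _; exact: lerD.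
- under eq_Rintegral do rewrite mulrDr.
  by rewrite RintegralD// z1 z2 addr0.
Qed.

Let orthZ c h : orth h -> orth (fun x => c * h x).
Proof.
move=> o1; have i1 := orthI o1.
case: o1 => [m1 [M1 b1] z1]; split.
- exact: measurable_funM.
- exists (`|c| * M1) => x; rewrite normrM ler_wpM2l//.
- under eq_Rintegral do rewrite mulrCA.
  by rewrite RintegralZl// z1 mulr0.
Qed.

Let orth_cos k : orth (fun x => cos (2 * pi * k%:~R * x)).
Proof.
split => //; last by exists 1 => x; exact: cos_max.
apply: continuous_measurable_fun => x.
have := @continuous_cos_affine R (2 * pi * k%:~R) 0.
by under eq_fun do rewrite addr0; apply.
Qed.

Let orth_sin k : orth (fun x => sin (2 * pi * k%:~R * x)).
Proof.
split => //; last by exists 1 => x; exact: sin_max.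
apply: continuous_measurable_fun => x.
have := @continuous_sin_affine R (2 * pi * k%:~R) 0.
by under eq_fun do rewrite addr0; apply.
Qed.

Let cosi (c d : R) (J : set R) : measurable J -> J `<=` `[0, 1[ ->
  mu.-integrable J (fun t => (cos (c * t + d))%:E).
Proof.
move=> mJ JI; apply: (integrable01_bounded_mul (M := 1)) => //.
  apply: measurable_funTS; apply: continuous_measurable_fun.
  exact: continuous_cos_affine.
by move=> *; exact: cos_max.
Qed.

Let sini (c d : R) (J : set R) : measurable J -> J `<=` `[0, 1[ ->
  mu.-integrable J (fun t => (sin (c * t + d))%:E).
Proof.
move=> mJ JI; apply: (integrable01_bounded_mul (M := 1)) => //.
  apply: measurable_funTS; apply: continuous_measurable_fun.
  exact: continuous_sin_affine.
by move=> *; exact: sin_max.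
Qed.

Let pcosi s x (J : set R) : measurable J -> J `<=` `[0, 1[ ->
  mu.-integrable J (fun t => (pcos s (x - t))%:E).
Proof.
move=> mJ JI; elim: s => [|p s IH].
  by under eq_fun do rewrite /pcos big_nil; exact: integrable0.
under eq_fun do rewrite /pcos big_cons -/(pcos s _) EFinD.
apply: integrableD => //.
under eq_fun do rewrite EFinM.
apply: integrableZl => //.
have := @cosi (- (2 * pi * p.2%:~R)) (2 * pi * p.2%:~R * x) J mJ JI.
by under eq_fun => t do rewrite mulNr addrC -mulrBr.
Qed.

(** Integrating in t first, cos (c (x - t)) = cos (c x) cos (c t) + sin (c x) sin (c t)
    shows that such an average of translates is a trigonometric polynomial
    in x. *)
Let orth_pcos s (J : set R) : measurable J -> J `<=` `[0, 1[ ->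
  orth (fun x => \int[mu]_(t in J) pcos s (x - t)).
Proof.
move=> mJ JI; elim: s => [|p s IH].
  under eq_fun do under eq_Rintegral do rewrite /pcos big_nil.
  under eq_fun do rewrite Rintegral_cst// mul0r.
  split; first exact: measurable_cst.
    by exists 0 => x; rewrite normr0.
  by under eq_Rintegral do rewrite mulr0; rewrite Rintegral_cst// mul0r.
pose c : R := 2 * pi * p.2%:~R.
have ci := @cosi c 0 J mJ JI; have si := @sini c 0 J mJ JI.
have E x : \int[mu]_(t in J) pcos (p :: s) (x - t) =
  ((p.1 * \int[mu]_(t in J) cos (c * t + 0)) * cos (c * x) +
   (p.1 * \int[mu]_(t in J) sin (c * t + 0)) * sin (c * x)) +
  \int[mu]_(t in J) pcos s (x - t).
  transitivity (\int[mu]_(t in J) ((p.1 * cos (c * x) * cos (c * t + 0) +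
      p.1 * sin (c * x) * sin (c * t + 0)) + pcos s (x - t))).
    apply: eq_Rintegral => t _; rewrite /pcos big_cons; congr (_ + _).
    by rewrite /c mulrBr cosB addr0; ring.
  have i1 : mu.-integrable J (fun t => (p.1 * cos (c * x) * cos (c * t + 0))%:E).
    by under eq_fun do rewrite EFinM; exact: integrableZl.
  have i2 : mu.-integrable J (fun t => (p.1 * sin (c * x) * sin (c * t + 0))%:E).
    by under eq_fun do rewrite EFinM; exact: integrableZl.
  rewrite RintegralD//; last 2 first.
  - exact: (integrableD _ i1 i2).
  - exact: pcosi.
  by rewrite RintegralD// !RintegralZl//; congr (_ + _); ring.
under eq_fun do rewrite E.
exact: (orthD (orthD (orthZ _ (orth_cos _)) (orthZ _ (orth_sin _))) IH).
Qed.

(** Over a full period only the constant terms survive, so the mass does not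
    depend on the centre x. *)
Let mass s x : \int[mu]_(t in `[0, 1[) pcos s (x - t) =
  \sum_(p <- s) p.1 * (p.2 == 0)%:R.
Proof.
elim: s => [|p s IH].
  under eq_Rintegral do rewrite /pcos big_nil.
  by rewrite big_nil Rintegral_cst// mul0r.
under eq_Rintegral do rewrite /pcos big_cons -/(pcos s _).
rewrite big_cons -IH.
have ci : mu.-integrable `[0, 1[
    (fun t : R => (cos (2 * pi * (- p.2)%:~R * t + 2 * pi * p.2%:~R * x))%:E).
  exact: cosi.
have E : \int[mu]_(t in `[0, 1[) (p.1 * cos (2 * pi * p.2%:~R * (x - t))) =
    p.1 * (p.2 == 0)%:R.
  transitivity (\int[mu]_(t in `[0, 1[)
     (p.1 * cos (2 * pi * (- p.2)%:~R * t + 2 * pi * p.2%:~R * x))).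
    apply: eq_Rintegral => t _; congr (_ * cos _).
    by rewrite mulrNz; ring.
  rewrite RintegralZl// Rintegral_cos oppr_eq0; case: eqVneq => [->|_].
    by rewrite mulr0 mul0r cos0 mulr1.
  by rewrite mul0r.
rewrite RintegralD//; first by rewrite E.
  have mI : measurable (`[0, 1[%classic : set (measurableTypeR R)) by [].
  have ci1 := integrableZl mI p.1 ci.
  apply: (eq_integrable _ _ _ _ ci1) => //.
  by move=> t _ /=; rewrite EFinM; congr (_ * (cos _)%:E)%E; rewrite mulrNz; ring.
exact: pcosi.
Qed.

Let peaki n x (J : set R) : measurable J -> J `<=` `[0, 1[ ->
  mu.-integrable J (fun t => (peak n (x - t))%:E).
Proof.
move=> mJ JI; have [s sE] := @peak_pcos R n.
by under eq_fun do rewrite sE; exact: pcosi.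
Qed.

Let EpeakE n x (J : set R) : measurable J -> J `<=` `[0, 1[ ->
  (\int[mu]_(t in J) (peak n (x - t))%:E)%E =
  (\int[mu]_(t in J) peak n (x - t))%:E.
Proof.
by move=> mJ JI; rewrite /Rintegral fineK//; apply: integrable_fin_num => //; exact: peaki.
Qed.

Let le_cos2pi (d : R) t : 0 < d <= 2^-1 -> d <= `|t| <= 1 - d ->
  cos (2 * pi * t) <= cos (2 * pi * d).
Proof.
move=> /andP[d0 d2] /andP[dt td]; have p0 := pi_gt0 R.
have -> : cos (2 * pi * t) = cos (2 * pi * `|t|).
  by rewrite -cos_norm normrM ger0_norm// mulr_ge0// ltW.
set u := `|t| in dt td *; have u0 : 0 < u by exact: lt_le_trans dt.
have H v : d <= v <= 2^-1 -> cos (2 * pi * v) <= cos (2 * pi * d).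
  move=> /andP[dv v2]; rewrite leNgt ltr_cos ?in_itv/= -?leNgt; last 2 first.
  - by apply/andP; split; nra.
  - by apply/andP; split; nra.
  by rewrite ler_pM2l// mulr_gt0.
have [u2|u2] := leP u 2^-1; first by apply: H; rewrite dt.
have -> : cos (2 * pi * u) = cos (2 * pi * (1 - u)).
  rewrite -[LHS]cosN -[LHS](cos2piZ 1); congr cos; ring.
by apply: H; apply/andP; split; lra.
Qed.

(** The points of [x, x + d/2] are within d/2 of x, and there the base of the power
    is at least its value at distance d/2. *)
Lemma peak_mass_ge (d : R) x n : 0 < d -> d <= x <= 1 - d ->
  d / 2 * ((1 + cos (pi * d)) / 2) ^+ n <= \int[mu]_(t in `[0, 1[) peak n (x - t).
Proof.
move=> d0 /andP[dx xd]; have p0 := pi_gt0 R.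
have d2 : d <= 2^-1 by lra.
pose q2 := (1 + cos (pi * d)) / 2; rewrite -/q2.
have q20 : 0 <= q2 by have := cos_geN1 (pi * d); rewrite /q2; lra.
rewrite -lee_fin -EpeakE//.
pose K := `[x, (x + d / 2)]%classic.
have mK : measurable (K : set (measurableTypeR R)) by exact: measurable_itv.
have xI : K `<=` `[0, 1[.
  by move=> t; rewrite /K/= !in_itv/= => /andP[xt tx]; apply/andP; split; lra.
apply: (@le_trans _ _ (\int[mu]_(t in K) (peak n (x - t))%:E)%E); last first.
  apply: ge0_subset_integral => //.
    by apply: (measurable_int mu); exact: peaki.
  by move=> t _; rewrite lee_fin peak_ge0.
apply: (@le_trans _ _ (\int[mu]_(t in K) (q2 ^+ n)%:E)%E).
  rewrite integral_cst ?/K//= lebesgue_measure_itv/= lte_fin ifT; last by lra.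
  by rewrite -EFinB -EFinM lee_fin mulrC ler_wpM2l ?exprn_ge0//; lra.
apply: ge0_le_integral => //.
- by move=> t _; rewrite lee_fin exprn_ge0.
- by apply: (measurable_int mu); exact: peaki.
- move=> t; rewrite /K/= in_itv/= => /andP[xt tx].
  rewrite lee_fin /peak lerXn2r ?nnegrE //.
  rewrite ler_pM2r// lerD2l -[leRHS]cosN leNgt ltr_cos ?in_itv/= -?leNgt.
  - by nra.
  - by apply/andP; split; nra.
  - by apply/andP; split; nra.
Qed.

(** At distance at least d from x the base of the power is at most q1, whereas the
    total mass is at least (d/2) q2^n with q2 > q1: the ratio is bounded by a
    multiple of (q1/q2)^n. *)
Lemma peak_concentrates (d : R) x (J : set R) : 0 < d -> d <= x <= 1 - d ->
    measurable J -> J `<=` `[0, 1[ -> (forall t, J t -> d <= `|x - t|) ->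
  (fun n => (\int[mu]_(t in J) peak n (x - t)) /
            (\int[mu]_(t in `[0, 1[) peak n (x - t))) @ \oo --> 0.
Proof.
move=> d0 dxd mJ JI Jd; have /andP[dx xd] := dxd; have p0 := pi_gt0 R.
pose q1 := (1 + cos (2 * pi * d)) / 2; pose q2 := (1 + cos (pi * d)) / 2.
have d2 : d <= 2^-1 by lra.
have q10 : 0 <= q1 by have := cos_geN1 (2 * pi * d); rewrite /q1; lra.
have q12 : q1 < q2.
  rewrite /q1 /q2 ltr_pM2r// ltrD2l ltr_cos ?in_itv/=; last 2 first.
  - by apply/andP; split; nra.
  - by apply/andP; split; nra.
  by nra.
have q20 : 0 < q2 by exact: le_lt_trans q12.
have muJ1 : (mu J <= 1)%E.
  apply: (@le_trans _ _ (mu `[0, 1[)); first by apply: le_measure; rewrite ?inE.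
  by rewrite lebesgue_measure_itv/= lte01 oppr0 adde0.
have upper n : \int[mu]_(t in J) peak n (x - t) <= q1 ^+ n.
  rewrite -lee_fin -EpeakE//.
  apply: (@le_trans _ _ (\int[mu]_(t in J) (q1 ^+ n)%:E)%E).
    apply: ge0_le_integral => //.
    - by move=> t _; rewrite lee_fin peak_ge0.
    - by apply: (measurable_int mu); exact: peaki.
    - move=> t Jt; rewrite lee_fin /peak lerXn2r ?nnegrE//.
      rewrite ler_pM2r// lerD2l; apply: le_cos2pi; first by rewrite d0.
      rewrite Jd//=; have := JI _ Jt; rewrite /= in_itv/= => /andP[t0 t1].
      by rewrite ler_norml; apply/andP; split; lra.
  rewrite integral_cst// -[leRHS]mule1; apply: lee_wpmul2l => //.
  by rewrite lee_fin exprn_ge0.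
have lower n := peak_mass_ge n d0 dxd.
apply: (@squeeze_cvgr _ _ _ _ (cst 0) (fun n => 2 / d * (q1 / q2) ^+ n)).
- near=> n; apply/andP; split.
    by rewrite divr_ge0//; apply: Rintegral_ge0 => t _; exact: peak_ge0.
  have l0 : 0 < d / 2 * q2 ^+ n by rewrite mulr_gt0 ?divr_gt0 ?exprn_gt0.
  rewrite ler_pdivrMr; last exact: lt_le_trans (lower n).
  apply: (le_trans (upper n)).
  apply: (@le_trans _ _ (2 / d * (q1 / q2) ^+ n * (d / 2 * q2 ^+ n))).
    have <- : (q1 / q2) ^+ n * q2 ^+ n = q1 ^+ n.
      by rewrite -exprMn divfK// gt_eqF.
    move: ((q1 / q2) ^+ n) (q2 ^+ n) => u v.
    rewrite le_eqVlt; apply/orP; left; apply/eqP.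
    by field; rewrite gt_eqF.
  apply: ler_wpM2l (lower n).
  by rewrite mulr_ge0 ?divr_ge0 ?exprn_ge0 ?divr_ge0 ?(ltW d0) ?(ltW q20).
- exact: cvg_cst.
- rewrite -[X in _ --> X](mulr0 (2 / d)); apply: cvgM; first exact: cvg_cst.
  apply: cvg_expr; rewrite ger0_norm; last by rewrite divr_ge0 ?(ltW q20).
  by rewrite ltr_pdivrMr// mul1r.
Unshelve. all: by end_near. Qed.

Let peak_mass n : exists2 c : R, 0 < c &
  forall x, \int[mu]_(t in `[0, 1[) peak n (x - t) = c.
Proof.
have [s sE] := @peak_pcos R n.
have cE x : \int[mu]_(t in `[0, 1[) peak n (x - t) =
  \sum_(p <- s) p.1 * (p.2 == 0)%:R.
  by rewrite -(mass s x); apply: eq_Rintegral => t _.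
exists (\sum_(p <- s) p.1 * (p.2 == 0)%:R) => //.
rewrite -(cE 2^-1); apply: lt_le_trans (peak_mass_ge (d := 2^-1) n _ _).
- by rewrite mulr_gt0 ?exprn_gt0// cos_pihalf addr0 divr_gt0.
- by rewrite invr_gt0.
- by apply/andP; split; lra.
Qed.

Let orth_peak n (J : set R) : measurable J -> J `<=` `[0, 1[ ->
  orth (fun x => \int[mu]_(t in J) peak n (x - t)).
Proof.
move=> mJ JI; have [s sE] := @peak_pcos R n.
by under eq_fun do under eq_Rintegral do rewrite sE; exact: orth_pcos.
Qed.

(** The function W n below is the indicator of [0, v) averaged against the
    normalised kernel. It is a trigonometric polynomial with values in [0, 1],
    hence orthogonal to g, and it converges to the indicator except at 0 and v;
    dominated convergence concludes. *)
Lemma Rintegral_prefix_eq0 (v : R) : 0 < v < 1 -> \int[mu]_(x in `[0, v[) g x = 0.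
Proof.
move=> /andP[v0 v1].
pose J := `[0, v[%classic; pose J' := `[v, 1[%classic.
have mI : measurable (`[0, 1[%classic : set (measurableTypeR R)) by exact: measurable_itv.
have mJ : measurable (J : set (measurableTypeR R)) by exact: measurable_itv.
have mJ' : measurable (J' : set (measurableTypeR R)) by exact: measurable_itv.
have JI : J `<=` `[0, 1[.
  by move=> t; rewrite /J/= !in_itv/= => /andP[-> /lt_trans ->].
have J'I : J' `<=` `[0, 1[.
  by move=> t; rewrite /J'/= !in_itv/= => /andP[/(lt_le_trans v0)/ltW -> ->].
have IE : `[0, 1[%classic = J `|` J'.
  by rewrite /J /J' -itv_bndbnd_setU// bnd_simp ltW.
have splitI n x : \int[mu]_(t in `[0, 1[) peak n (x - t) =
  \int[mu]_(t in J) peak n (x - t) + \int[mu]_(t in J') peak n (x - t).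
  rewrite IE Rintegral_setU//.
    by rewrite -IE; exact: peaki.
  apply/disj_setPS => t []; rewrite /J /J'/= !in_itv/= => /andP[_ tv] /andP[vt _].
  by move: vt; rewrite leNgt tv.
pose W n x := (\int[mu]_(t in J) peak n (x - t)) /
              (\int[mu]_(t in `[0, 1[) peak n (x - t)).
have Wo n : orth (W n).
  rewrite /W; have [c _ cE] := peak_mass n.
  have := orthZ c^-1 (orth_peak n mJ JI); congr orth.
  by apply/funext => x; rewrite cE mulrC.
have W01 n x : 0 <= W n x <= 1.
  rewrite /W; have [c c0 cE] := peak_mass n.
  have pJ : 0 <= \int[mu]_(t in J) peak n (x - t).
    by apply: Rintegral_ge0 => t _; exact: peak_ge0.
  have pJ' : 0 <= \int[mu]_(t in J') peak n (x - t).
    by apply: Rintegral_ge0 => t _; exact: peak_ge0.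
  rewrite cE divr_ge0 ?(ltW c0)//= ler_pdivrMr// mul1r -(cE x) splitI.
  by rewrite lerDl.
have Wcvg x : `[0, 1[%classic x -> x <> 0 -> x <> v ->
    (fun n => W n x) @ \oo --> (\1_J x : R).
  rewrite /= in_itv/= => /andP[x0 x1] /eqP xn0 /eqP xnv.
  have {}x0 : 0 < x by rewrite lt_neqAle eq_sym xn0.
  have [xv|vx|] := ltgtP x v; last by move/eqP; rewrite (negbTE xnv).
  - rewrite indicE mem_set; last by rewrite /J/= in_itv/= xv ltW.
    have -> : W ^~ x = (fun n => 1 - (\int[mu]_(t in J') peak n (x - t)) /
            (\int[mu]_(t in `[0, 1[) peak n (x - t))).
      apply/funext => n; rewrite /W; have [c c0 cE] := peak_mass n.
      apply/eqP; rewrite -subr_eq0 opprB addrA -mulrDl addrC -splitI cE.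
      by rewrite (divff (lt0r_neq0 c0)) addNr.
    rewrite -[X in _ --> X]subr0; apply: cvgB; first exact: cvg_cst.
    (* half-width of a neighbourhood of x that stays inside [0, v) *)
    pose d := Num.min x (v - x).
    have d1 : d <= x by rewrite /d ge_min lexx.
    have d2 : d <= v - x by rewrite /d ge_min lexx orbT.
    have d0 : 0 < d by rewrite /d lt_min x0 subr_gt0.
    apply: (@peak_concentrates d) => //; first by apply/andP; split; lra.
    move=> t; rewrite /J'/= in_itv/= => /andP[vt t1].
    by rewrite ler0_norm; lra.
  - rewrite indicE memNset; last by rewrite /J/= in_itv/= => /andP[_]; rewrite ltNge ltW.
    (* half-width of a neighbourhood of x that avoids [0, v) *)
    pose d := Num.min (x - v) (1 - x).
    have d1 : d <= x - v by rewrite /d ge_min lexx.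
    have d2 : d <= 1 - x by rewrite /d ge_min lexx orbT.
    have d0 : 0 < d by rewrite /d lt_min !subr_gt0 vx.
    apply: (@peak_concentrates d) => //; first by apply/andP; split; lra.
    move=> t; rewrite /J/= in_itv/= => /andP[vt t1].
    by rewrite ger0_norm; lra.
have mg : measurable_fun (`[0, 1[%classic : set (measurableTypeR R)) (EFin \o g) by exact: (measurable_int mu).
have [|||||] := @dominated_convergence _ _ _ mu `[0, 1[%classic mI
  (fun n x => (g x * W n x)%:E) ((EFin \o g) \_ J)
  (fun x => `|(EFin \o g) x|)%E.
- by move=> n; apply: (measurable_int mu); exact: orthI.
- by apply/measurable_restrict => //; apply: measurable_funS mg => // t [].
- have : mu.-negligible [set 0; v].
    exists [set 0; v]; split => //; first exact: measurableU.
    by apply: countable_lebesgue_measure0; exact: finite_set_countable.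
  apply: negligibleS => x /= /not_implyP[xI xn].
  apply: contrapT => /not_orP[x0 xv]; apply: xn.
  rewrite (_ : _ x = (g x * \1_J x)%:E); last first.
    by rewrite /patch indicE; case: ifP => _ /=; rewrite ?mulr1 ?mulr0.
  apply/fine_cvgP; split; first by near=> n.
  by apply: cvgM; [exact: cvg_cst|exact: Wcvg].
- exact: integrable_abse.
- apply: aeW => x n _; rewrite lee_fin normrM ler_piMr//.
  by have /andP[W0 W1] := W01 n x; rewrite ger0_norm.
move=> _ _; rewrite -integral_mkcondr (setIidr JI) => gJ.
rewrite /Rintegral (_ : integral _ _ _ = 0)//.
apply: (cvg_unique _ gJ) => //.
rewrite (_ : [sequence _]_n = cst 0); first exact: cvg_cst.
apply/funext => n /=; have iW := orthI (Wo n); have [_ _ gW] := Wo n.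
rewrite -[LHS]fineK; last by apply: integrable_fin_num => //; exact: iW.
by rewrite -/(Rintegral _ _ _) gW.
Unshelve. all: by end_near. Qed.

(** The primitive of g is constant, and by Lebesgue differentiation g is almost
    everywhere its derivative. *)
Lemma ae_eq0_of_coeffs : {ae mu, forall x, `[0, 1[%classic x -> g x = 0}.
Proof.
have mI : measurable (`[0, 1[%classic : set (measurableTypeR R)) by exact: measurable_itv.
pose f := g \_ `[0, 1[.
have fi y : mu.-integrable [set` Interval (BLeft 0) (BRight y)] (EFin \o f).
  rewrite /f -restrict_EFin; apply/integrable_restrict => //.
  by apply: integrableS ig => //; exact: measurableI.
have lf : locally_integrable setT f by exact: integrable_locally_restrict.
have := FTC1 fi lf.
have : mu.-negligible [set 0 : R].
  by exists [set 0]; split => //; exact: lebesgue_measure_set1.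
move=> n0 h; have := negligibleU n0 h.
apply: negligibleS => x /= /not_implyP[]; rewrite in_itv/= => /andP[x0 x1] gx.
have [->|xn0] := eqVneq x 0; [by left|right] => H.
have {}x0 : 0 < x by rewrite lt_neqAle eq_sym xn0.
have [|_ F'] := H; first by rewrite lte_fin.
apply: gx; rewrite -[LHS](_ : f x = g x); last first.
  by rewrite /f /patch mem_set//= in_itv/= x1 ltW.
rewrite -F' derive1E (near_eq_derive (g := cst 0)) ?derive_cst//.
near=> y.
have /andP[y0 y1] : 0 < y < 1.
  by apply/andP; split; near: y; [exact: lt_nbhsr|exact: lt_nbhsl].
rewrite -Rintegral_itv_bndo_bndc; last first.
  by apply: integrableS (fi y) => // t /=; rewrite !in_itv/= => /andP[-> /ltW].
rewrite -[RHS](@Rintegral_prefix_eq0 y) ?y0//.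
apply: eq_Rintegral => t; rewrite inE/= in_itv/= => /andP[t0 ty].
by rewrite /f /patch mem_set//= in_itv/= t0 (lt_trans ty).
Unshelve. all: by end_near. Qed.

End uniqueness.

(** * Complex-valued functions and their integrals *)

Section complex_numbers.
Context {R : realType}.
Implicit Types (z w : R[i]) (t : R).

Lemma sqnormcE z : sqnormc z = complex.Re z ^+ 2 + complex.Im z ^+ 2.
Proof. by case: z => x y; rewrite /sqnormc/= sqr_sqrtr// addr_ge0 ?sqr_ge0. Qed.

Lemma sqnormc_ge0 z : 0 <= sqnormc z.
Proof. by rewrite sqnormcE addr_ge0 ?sqr_ge0. Qed.

Lemma sqnormcM z w : sqnormc (z * w) = sqnormc z * sqnormc w.
Proof. by rewrite /sqnormc ComplexField.Normc.normcM exprMn. Qed.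

Lemma conjcE (x y : R) : (x +i* y)^* = x -i* y.
Proof. by []. Qed.

Lemma sqnormcJ z : sqnormc z^* = sqnormc z.
Proof. by case: z => x y; rewrite conjcE !sqnormcE/= sqrrN. Qed.

Lemma sqnormcC (x : R) : sqnormc x%:C = x ^+ 2.
Proof. by rewrite sqnormcE/= expr0n addr0. Qed.

Lemma sqnormc_eq0 z : sqnormc z = 0 -> z = 0.
Proof. by move=> /eqP; rewrite sqrf_eq0 => /eqP /ComplexField.Normc.eq0_normc. Qed.

Lemma sqnormcN z : sqnormc (- z) = sqnormc z.
Proof. by case: z => x y; rewrite !sqnormcE/= !sqrrN. Qed.

Lemma sqnormcD_le z w : sqnormc (z + w) <= 2 * sqnormc z + 2 * sqnormc w.
Proof.
case: z => a b; case: w => c d; rewrite !sqnormcE/=.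
rewrite -subr_ge0 (_ : _ - _ = (a - c) ^+ 2 + (b - d) ^+ 2); last by ring.
by rewrite addr_ge0// sqr_ge0.
Qed.

Lemma expiRD (s t : R) : expiR (s + t) = expiR s * expiR t.
Proof. by rewrite /expiR cosD sinD; simpc; congr (_ +i* _); rewrite addrC. Qed.

Lemma expiRJ t : (expiR t)^* = expiR (- t).
Proof. by rewrite /expiR conjcE cosN sinN. Qed.

Lemma sqnormc_expiR t : sqnormc (expiR t) = 1.
Proof. by rewrite sqnormcE/= cos2Dsin2. Qed.

Lemma cReM z w : complex.Re (z * w) =
  complex.Re z * complex.Re w - complex.Im z * complex.Im w.
Proof. by case: z => a b; case: w => c d. Qed.

Lemma cImM z w : complex.Im (z * w) =
  complex.Re z * complex.Im w + complex.Im z * complex.Re w.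
Proof. by case: z => a b; case: w => c d /=; rewrite addrC. Qed.

Lemma cReJ z : complex.Re z^* = complex.Re z. Proof. by case: z. Qed.
Lemma cImJ z : complex.Im z^* = - complex.Im z. Proof. by case: z. Qed.
Lemma cReD z w : complex.Re (z + w) = complex.Re z + complex.Re w.
Proof. by case: z; case: w. Qed.
Lemma cImD z w : complex.Im (z + w) = complex.Im z + complex.Im w.
Proof. by case: z; case: w. Qed.
Lemma cReN z : complex.Re (- z) = - complex.Re z. Proof. by case: z. Qed.
Lemma cImN z : complex.Im (- z) = - complex.Im z. Proof. by case: z. Qed.

Lemma eq_complexP z w : complex.Re z = complex.Re w ->
  complex.Im z = complex.Im w -> z = w.
Proof. by case: z => a b; case: w => c d /= -> ->. Qed.

Lemma conj_scaled_expiR (r t : R) : (r%:C * expiR t)^* = r%:C * expiR (- t).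
Proof.
by rewrite -expiRJ; apply: eq_complexP; rewrite !(cReJ, cImJ, cReM, cImM)/=; ring.
Qed.

Lemma sqnormc_mulJ z : z * z^* = (sqnormc z)%:C.
Proof.
apply: eq_complexP; rewrite ?cReM ?cImM cReJ cImJ/= ?sqnormcE; last by ring.
by ring.
Qed.

Lemma sqnormcB z w :
  sqnormc (z - w) + 2 * complex.Re (z * w^*) = sqnormc z + sqnormc w.
Proof. by rewrite !sqnormcE cReM cReD cImD cReN cImN cReJ cImJ; ring. Qed.

Lemma abs_Re_mul_le z w : `|complex.Re (z * w)| <= sqnormc z + sqnormc w.
Proof.
rewrite !sqnormcE cReM; case: z => a b; case: w => c d /=.
rewrite ler_norml; apply/andP; split; rewrite -subr_ge0.
  rewrite (_ : _ - _ = 2^-1 * ((a + c) ^+ 2 + (b - d) ^+ 2 +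
     a ^+ 2 + b ^+ 2 + c ^+ 2 + d ^+ 2)); last by field.
  by rewrite mulr_ge0// !addr_ge0 ?sqr_ge0.
rewrite (_ : _ - _ = 2^-1 * ((a - c) ^+ 2 + (b + d) ^+ 2 +
   a ^+ 2 + b ^+ 2 + c ^+ 2 + d ^+ 2)); last by field.
by rewrite mulr_ge0// !addr_ge0 ?sqr_ge0.
Qed.

(** The weight e lets an L^2 bound control an L^1 norm without square roots of
    integrals: with w = 1 it bounds |Re z| by e^-1 |z|^2 + e. *)
Lemma abs_Re_mul_le_eps (e : R) z w : 0 < e ->
  `|complex.Re (z * w)| <= e^-1 * sqnormc z + e * sqnormc w.
Proof.
move=> e0; have s0 : 0 < Num.sqrt e by rewrite sqrtr_gt0.
have sn : Num.sqrt e != 0 by rewrite gt_eqF.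
have -> : z * w = ((Num.sqrt e)^-1%:C * z) * ((Num.sqrt e)%:C * w).
  rewrite mulrACA -rmorphM mulVf// mul1r//.
apply: (le_trans (abs_Re_mul_le _ _)).
by rewrite !sqnormcM !sqnormcC exprVn sqr_sqrtr// ltW.
Qed.

Lemma abs_Re_le_sqnormc z : `|complex.Re z| <= 1 + sqnormc z.
Proof.
by have := abs_Re_mul_le 1 z; rewrite mul1r sqnormcC expr1n.
Qed.

Lemma sqnormcNi : sqnormc (- 'i%C : R[i]) = 1.
Proof. by rewrite sqnormcN sqnormcE/= expr0n expr1n add0r. Qed.

Lemma cReMNi z : complex.Re (z * (- 'i%C)) = complex.Im z.
Proof. by rewrite cReM/=; ring. Qed.

Lemma abs_Im_le_sqnormc z : `|complex.Im z| <= 1 + sqnormc z.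
Proof.
by have := abs_Re_le_sqnormc (z * (- 'i%C)); rewrite sqnormcM sqnormcNi mulr1 cReMNi.
Qed.

End complex_numbers.

Section complex_measurable.
Context d (T : measurableType d) (R : realType) (D : set T).
Implicit Types f g : T -> R[i].

Lemma cmeasurable_cst (c : R[i]) : cmeasurable_fun D (fun _ : T => c).
Proof. by split; exact: measurable_cst. Qed.

Lemma cmeasurableD f g : cmeasurable_fun D f -> cmeasurable_fun D g ->
  cmeasurable_fun D (fun x => f x + g x).
Proof.
move=> [f1 f2] [g1 g2]; split.
  by under eq_fun do rewrite cReD; exact: measurable_funD.
by under eq_fun do rewrite cImD; exact: measurable_funD.
Qed.

Lemma cmeasurableM f g : cmeasurable_fun D f -> cmeasurable_fun D g ->
  cmeasurable_fun D (fun x => f x * g x).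
Proof.
move=> [f1 f2] [g1 g2]; split.
  under eq_fun do rewrite cReM; apply: measurable_funB; exact: measurable_funM.
under eq_fun do rewrite cImM; apply: measurable_funD; exact: measurable_funM.
Qed.

Lemma cmeasurableJ f : cmeasurable_fun D f -> cmeasurable_fun D (fun x => (f x)^*).
Proof.
move=> [f1 f2]; split; first by under eq_fun do rewrite cReJ.
by under eq_fun do rewrite cImJ; exact: measurableT_comp.
Qed.

Lemma cmeasurableN f : cmeasurable_fun D f -> cmeasurable_fun D (fun x => - f x).
Proof.
move=> [f1 f2]; split.
  by under eq_fun do rewrite cReN; exact: measurableT_comp.
by under eq_fun do rewrite cImN; exact: measurableT_comp.
Qed.

Lemma cmeasurable_real (h : T -> R) : measurable_fun D h ->
  cmeasurable_fun D (fun x => (h x)%:C).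
Proof. by split => //; exact: measurable_cst. Qed.

Lemma cmeasurable_expiR (h : T -> R) : measurable_fun D h ->
  cmeasurable_fun D (fun x => expiR (h x)).
Proof.
by move=> mh; split; apply: measurableT_comp => //; apply: continuous_measurable_fun;
  [exact: continuous_cos|exact: continuous_sin].
Qed.

Lemma cmeasurable_sum (I : Type) (s : seq I) (F : I -> T -> R[i]) :
  (forall i, cmeasurable_fun D (F i)) ->
  cmeasurable_fun D (fun x => \sum_(i <- s) F i x).
Proof.
move=> mF; elim: s => [|i s IH].
  by under eq_fun do rewrite big_nil; exact: cmeasurable_cst.
by under eq_fun do rewrite big_cons; exact: cmeasurableD.
Qed.

Lemma measurable_sqnormc f : cmeasurable_fun D f ->
  measurable_fun D (fun x => sqnormc (f x)).
Proof.
move=> [f1 f2]; under eq_fun do rewrite sqnormcE.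
by apply: measurable_funD; apply: measurable_funX.
Qed.

Lemma cmeasurable_funS (E : set T) f : measurable E -> D `<=` E ->
  cmeasurable_fun E f -> cmeasurable_fun D f.
Proof. by move=> mE DE [f1 f2]; split; apply: measurable_funS; eauto. Qed.

End complex_measurable.

Section rect_projections.
Context d1 d2 (T1 : measurableType d1) (T2 : measurableType d2) (R : realType).
Variables (A : set T1) (B : set T2) (mA : measurable A) (mB : measurable B).

Lemma cmeasurable_fst (h : T1 -> R[i]) :
  cmeasurable_fun A h -> cmeasurable_fun (A `*` B) (fun p => h p.1).
Proof.
have pA : (@fst T1 T2) @` (A `*` B) `<=` A by move=> _ [p [Ap _] <-].
have mf : measurable_fun (A `*` B) (@fst T1 T2).
  by apply: measurable_funTS; exact: measurable_fst.
by move=> [h1 h2]; split; [exact: (measurable_comp mA pA h1)|exact: (measurable_comp mA pA h2)].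
Qed.

Lemma cmeasurable_snd (h : T2 -> R[i]) :
  cmeasurable_fun B h -> cmeasurable_fun (A `*` B) (fun p => h p.2).
Proof.
have pB : (@snd T1 T2) @` (A `*` B) `<=` B by move=> _ [p [_ Bp] <-].
have mf : measurable_fun (A `*` B) (@snd T1 T2).
  by apply: measurable_funTS; exact: measurable_snd.
by move=> [h1 h2]; split; [exact: (measurable_comp mB pB h1)|exact: (measurable_comp mB pB h2)].
Qed.

End rect_projections.

Section complex_integral.
Context d (T : measurableType d) (R : realType).
Context (mu : {measure set T -> \bar R}) (D : set T) (mD : measurable D).
Implicit Types f g : T -> R[i].

Definition cintegrable f :=
  mu.-integrable D (fun x => (complex.Re (f x))%:E) /\
  mu.-integrable D (fun x => (complex.Im (f x))%:E).

(** This is [sqnormL2] with the measure as a parameter, so that it also makes sense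
    on the plane. *)
Definition sqnorm2 f : \bar R := (\int[mu]_(x in D) (sqnormc (f x))%:E)%E.

Lemma sqnorm2_ge0 f : (0 <= sqnorm2 f)%E.
Proof. by apply: integral_ge0 => x _; rewrite lee_fin sqnormc_ge0. Qed.

Lemma cintegrable_measurable f : cintegrable f -> cmeasurable_fun D f.
Proof. by move=> [f1 f2]; split; apply/measurable_EFinP; exact: (measurable_int mu). Qed.

Lemma cintegrableD f g : cintegrable f -> cintegrable g ->
  cintegrable (fun x => f x + g x).
Proof.
move=> [f1 f2] [g1 g2]; split.
  by under eq_fun do rewrite cReD EFinD; exact: integrableD.
by under eq_fun do rewrite cImD EFinD; exact: integrableD.
Qed.

Lemma cintegralD f g : cintegrable f -> cintegrable g ->
  cintegral mu D (fun x => f x + g x) = cintegral mu D f + cintegral mu D g.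
Proof.
move=> [f1 f2] [g1 g2]; rewrite /cintegral; simpc; congr (_ +i* _).
  by under eq_Rintegral do rewrite cReD; exact: RintegralD.
by under eq_Rintegral do rewrite cImD; exact: RintegralD.
Qed.

Lemma cintegrableZ (c : R[i]) f : cintegrable f -> cintegrable (fun x => c * f x).
Proof.
move=> [f1 f2]; split.
  under eq_fun do rewrite cReM EFinB !EFinM.
  by apply: integrableB => //; exact: integrableZl.
under eq_fun do rewrite cImM EFinD !EFinM.
by apply: integrableD => //; exact: integrableZl.
Qed.

Lemma cintegralZ (c : R[i]) f : cintegrable f ->
  cintegral mu D (fun x => c * f x) = c * cintegral mu D f.
Proof.
move=> [f1 f2]; apply: eq_complexP; rewrite /cintegral/=.
  under eq_Rintegral do rewrite cReM.
  rewrite RintegralB//; last 2 first.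
  - exact: (integrableZl mD (complex.Re c) f1).
  - exact: (integrableZl mD (complex.Im c) f2).
  by rewrite !RintegralZl// cReM.
under eq_Rintegral do rewrite cImM.
rewrite RintegralD//; last 2 first.
- exact: (integrableZl mD (complex.Re c) f2).
- exact: (integrableZl mD (complex.Im c) f1).
by rewrite !RintegralZl// cImM.
Qed.

Lemma cintegrable0 : cintegrable (fun _ : T => 0).
Proof. by split; exact: integrable0. Qed.

Lemma cintegral0 : cintegral mu D (fun _ : T => 0) = 0.
Proof. by rewrite /cintegral; apply: eq_complexP => /=; rewrite Rintegral_cst// mul0r. Qed.

Lemma cintegrable_sum (I : Type) (s : seq I) (F : I -> T -> R[i]) :
  (forall i, cintegrable (F i)) ->
  cintegrable (fun x => \sum_(i <- s) F i x) /\
  cintegral mu D (fun x => \sum_(i <- s) F i x) =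
    \sum_(i <- s) cintegral mu D (F i).
Proof.
move=> iF; elim: s => [|i s [IH1 IH2]].
  under eq_fun do rewrite big_nil.
  by rewrite big_nil cintegral0; split => //; exact: cintegrable0.
under eq_fun do rewrite big_cons.
by rewrite big_cons cintegralD// IH2; split => //; exact: cintegrableD.
Qed.

Lemma eq_cintegral f g : (forall x, D x -> f x = g x) ->
  cintegral mu D f = cintegral mu D g.
Proof.
move=> fg; rewrite /cintegral; congr (_ +i* _); apply: eq_Rintegral => x;
  by rewrite inE => Dx; rewrite fg.
Qed.

Lemma eq_cintegrable f g : (forall x, D x -> f x = g x) ->
  cintegrable f -> cintegrable g.
Proof.
move=> fg [f1 f2]; split.
  by apply: (eq_integrable mD _ _ _ f1) => x; rewrite inE => Dx; rewrite fg.
by apply: (eq_integrable mD _ _ _ f2) => x; rewrite inE => Dx; rewrite fg.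
Qed.

Lemma eq_sqnorm2 f g : (forall x, D x -> f x = g x) -> sqnorm2 f = sqnorm2 g.
Proof. by move=> fg; apply: eq_integral => x; rewrite inE => Dx; rewrite fg. Qed.

Lemma cintegrableM_bounded f g (M : R) : cintegrable f -> cmeasurable_fun D g ->
  (forall x, D x -> sqnormc (g x) <= M) -> cintegrable (fun x => f x * g x).
Proof.
move=> [f1 f2] [g1 g2] gM.
have gRe x : D x -> `|complex.Re (g x)| <= 1 + M.
  by move=> Dx; apply: le_trans (abs_Re_le_sqnormc _) _; rewrite lerD2l gM.
have gIm x : D x -> `|complex.Im (g x)| <= 1 + M.
  by move=> Dx; apply: le_trans (abs_Im_le_sqnormc _) _; rewrite lerD2l gM.
split.
  under eq_fun do rewrite cReM EFinB.
  exact: (integrableB mD (integrable_bounded_mul mD f1 g1 gRe)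
    (integrable_bounded_mul mD f2 g2 gIm)).
under eq_fun do rewrite cImM EFinD.
exact: (integrableD mD (integrable_bounded_mul mD f1 g2 gIm)
  (integrable_bounded_mul mD f2 g1 gRe)).
Qed.

Lemma sqnorm2_integrable f : cmeasurable_fun D f -> (sqnorm2 f < +oo)%E ->
  mu.-integrable D (fun x => (sqnormc (f x))%:E).
Proof.
move=> mf fi; apply/integrableP; split.
  by apply/measurable_EFinP; exact: measurable_sqnormc.
by under eq_integral do rewrite gee0_abs ?lee_fin ?sqnormc_ge0//.
Qed.

Lemma cintegrable_mul2 f g : cmeasurable_fun D f -> cmeasurable_fun D g ->
  (sqnorm2 f < +oo)%E -> (sqnorm2 g < +oo)%E ->
  cintegrable (fun x => f x * (g x)^*).
Proof.
move=> mf mg fi gi.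
have H := integrableD mD (sqnorm2_integrable mf fi) (sqnorm2_integrable mg gi).
have [m1 m2] := cmeasurableM mf (cmeasurableJ mg).
split; apply: le_integrable H => //; try exact/measurable_EFinP.
  move=> x Dx /=; rewrite lee_fin -sqnormcJ [leRHS]ger0_norm ?addr_ge0 ?sqnormc_ge0//.
  by rewrite sqnormcJ -(sqnormcJ (g x)); exact: abs_Re_mul_le.
move=> x Dx /=; rewrite lee_fin [leRHS]ger0_norm ?addr_ge0 ?sqnormc_ge0//.
have := abs_Re_mul_le (f x * (- 'i%C)) (g x)^*.
by rewrite sqnormcM sqnormcNi sqnormcJ mulr1 mulrAC cReMNi.
Qed.

Lemma sqnorm2D_lty f g : cmeasurable_fun D f -> cmeasurable_fun D g ->
  (sqnorm2 f < +oo)%E -> (sqnorm2 g < +oo)%E ->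
  (sqnorm2 (fun x => (f x + g x)%R) < +oo)%E.
Proof.
move=> mf mg fi gi.
have fi2 := integrableZl mD 2 (sqnorm2_integrable mf fi).
have gi2 := integrableZl mD 2 (sqnorm2_integrable mg gi).
have /integrableP[_ H] := integrableD mD fi2 gi2.
apply: le_lt_trans H; apply: ge0_le_integral => //.
- by move=> x _; rewrite lee_fin sqnormc_ge0.
- by apply/measurable_EFinP; apply: measurable_sqnormc; exact: cmeasurableD.
- apply: measurableT_comp => //; apply: emeasurable_funD;
  by apply: (measurable_int mu).
- move=> x _ /=; rewrite lee_fin ger0_norm; first exact: sqnormcD_le.
  by apply: addr_ge0; apply: mulr_ge0 => //; exact: sqnormc_ge0.
Qed.

Lemma sqnorm2Z (c : R[i]) f : cmeasurable_fun D f ->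
  sqnorm2 (fun x => c * f x) = ((sqnormc c)%:E * sqnorm2 f)%E.
Proof.
move=> mf; rewrite /sqnorm2; under eq_integral do rewrite sqnormcM EFinM.
rewrite ge0_integralZl ?lee_fin ?sqnormc_ge0//.
  by apply/measurable_EFinP; exact: measurable_sqnormc.
by move=> x _; rewrite lee_fin sqnormc_ge0.
Qed.

(** The polarisation identity, with the inner product moved to the left because
    extended reals do not cancel. *)
Lemma sqnorm2B f g : cmeasurable_fun D f -> cmeasurable_fun D g ->
  (sqnorm2 f < +oo)%E -> (sqnorm2 g < +oo)%E ->
  (sqnorm2 (fun x => (f x - g x)%R) +
     (2 * complex.Re (cintegral mu D (fun x => f x * (g x)^*)))%:E =
   sqnorm2 f + sqnorm2 g)%E.
Proof.
move=> mf mg fi gi; have [i1 _] := cintegrable_mul2 mf mg fi gi.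
have if2 := sqnorm2_integrable mf fi; have ig2 := sqnorm2_integrable mg gi.
have mfg : cmeasurable_fun D (fun x => f x - g x) by exact/cmeasurableD/cmeasurableN.
have fgi : (sqnorm2 (fun x => (f x - g x)%R) < +oo)%E.
  apply: sqnorm2D_lty => //; first exact: cmeasurableN.
  by rewrite /sqnorm2; under eq_integral do rewrite sqnormcN.
have ifg := sqnorm2_integrable mfg fgi.
have i2 := integrableZl mD 2 i1.
rewrite EFinM /cintegral/= /Rintegral fineK; last exact: integrable_fin_num.
rewrite -integralZl// /sqnorm2 -integralD// -integralD//.
apply: eq_integral => x _; rewrite -EFinM -!EFinD; congr (_ %:E).
exact: sqnormcB.
Qed.

Lemma ae_eq_cintegral f g : cmeasurable_fun D f -> cmeasurable_fun D g ->
  {ae mu, forall x, D x -> f x = g x} -> cintegral mu D f = cintegral mu D g.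
Proof.
move=> [f1 f2] [g1 g2] fg; rewrite /cintegral; congr (_ +i* _);
  rewrite /Rintegral; congr fine; apply: ae_eq_integral => //;
  try (by apply/measurable_EFinP);
  by apply: ae_imply fg => x h Dx /=; rewrite h.
Qed.

End complex_integral.

(** * Trigonometric polynomials on [0, 1) *)

Section orthonormal_system.
Context {R : realType}.
Local Notation mu := (@lebesgue_measure R).
Local Notation I := (`[0, 1[%classic : set (measurableTypeR R)).
Implicit Types (t : R) (n : nat) (k j : int) (G : R -> R[i]) (c : int -> R[i]).

(** The sign of the exponent is that of [Theta_term], so that the coefficients of
    a Theta series are Fourier coefficients in the sense of [fcoef]. *)
Definition char k t : R[i] := expiR (- (2 * pi * k%:~R * t)).

Definition fcoef G k : R[i] := cintegral mu I (fun t => G t * (char k t)^*).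

Lemma measurableI01 : measurable I.
Proof. exact: measurable_itv. Qed.
Local Hint Resolve measurableI01 : core.

Lemma measure01 : mu I = 1%E.
Proof. by rewrite lebesgue_measure_itv/= lte01 oppr0 adde0. Qed.

Lemma measurable_char (D : set (measurableTypeR R)) k :
  cmeasurable_fun D (char k).
Proof.
apply: cmeasurable_expiR; apply: measurable_funTS.
by apply: measurableT_comp => //; apply: mulrl_measurable.
Qed.

Lemma sqnormc_char k t : sqnormc (char k t) = 1.
Proof. exact: sqnormc_expiR. Qed.

Lemma charN j t : char (- j) t = (char j t)^*.
Proof. by rewrite /char expiRJ intrN; congr expiR; ring. Qed.

Lemma charD j k t : char (j + k) t = char j t * char k t.
Proof. by rewrite /char -expiRD intrD; congr expiR; ring. Qed.

Lemma charD1 k t : char k (t + 1) = char k t.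
Proof.
have e1 : expiR (- (2 * pi * k%:~R)) = 1 :> R[i].
  have c1 : cos (2 * pi * k%:~R) = 1 :> R by rewrite -[X in cos X]addr0 cos2piZ cos0.
  have s1 : sin (2 * pi * k%:~R) = 0 :> R.
    by apply/eqP; rewrite -sqrf_eq0 -(addKr (cos (2 * pi * k%:~R) ^+ 2) (sin _ ^+ 2)) cos2Dsin2 c1; apply/eqP; ring.
  by rewrite /expiR cosN sinN c1 s1 oppr0.
rewrite /char -[RHS]mulr1 -e1 -expiRD; congr expiR; ring.
Qed.

Lemma charJ_mul j k t : char j t * (char k t)^* = expiR (2 * pi * (k - j)%:~R * t).
Proof. by rewrite /char expiRJ -expiRD intrB; congr expiR; ring. Qed.

Lemma cintegrable_cst01 (z : R[i]) : cintegrable mu I (fun=> z).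
Proof.
split.
  by apply: (@integrable01_bounded_mul R (fun=> complex.Re z) I `|complex.Re z|).
by apply: (@integrable01_bounded_mul R (fun=> complex.Im z) I `|complex.Im z|).
Qed.

Lemma cintegrable_char k : cintegrable mu I (char k).
Proof.
have := cintegrableM_bounded measurableI01 (cintegrable_cst01 1)
  (measurable_char I k) (M := 1).
move=> h; apply: eq_cintegrable (h _) => //; first by move=> x _; rewrite mul1r.
by move=> x _; rewrite sqnormc_char.
Qed.

Lemma cintegrable_charJ G k : cintegrable mu I G ->
  cintegrable mu I (fun t => G t * (char k t)^*).
Proof.
move=> iG; apply: (cintegrableM_bounded measurableI01 iG _ (M := 1)) => //.
  exact/cmeasurableJ/measurable_char.
by move=> x _; rewrite sqnormcJ sqnormc_char.
Qed.

Lemma fcoef_char j k : fcoef (char j) k = (j == k)%:R.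
Proof.
rewrite /fcoef; under eq_cintegral do rewrite charJ_mul.
apply: eq_complexP; rewrite /cintegral/= /expiR/=.
  have := @Rintegral_cos R (k - j) 0; under eq_Rintegral do rewrite addr0.
  move=> ->; rewrite cos0 mulr1 subr_eq0 eq_sym.
  by case: eqP.
have := @Rintegral_cos R (k - j) (- (pi / 2)).
under eq_Rintegral do rewrite cosBpihalf.
by move=> ->; rewrite cosN cos_pihalf mulr0; case: eqP.
Qed.

Lemma sqnorm2_cst01 (z : R[i]) : sqnorm2 mu I (fun=> z) = (sqnormc z)%:E.
Proof.
by rewrite /sqnorm2 integral_cst// -[RHS]mule1; congr (_ * _)%E; exact: measure01.
Qed.

Lemma cintegrable01_sq G : cmeasurable_fun I G -> (sqnorm2 mu I G < +oo)%E ->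
  cintegrable mu I G.
Proof.
move=> mG Gi.
have := cintegrable_mul2 measurableI01 mG (cmeasurable_cst I 1) Gi.
rewrite sqnorm2_cst01 ltry => /(_ isT).
apply: eq_cintegrable => // x _.
by rewrite rmorph1 mulr1.
Qed.

Section trigonometric_polynomial.
Variables (s : seq int) (us : uniq s) (c : int -> R[i]).

Definition tpoly (s : seq int) (c : int -> R[i]) t := \sum_(k <- s) c k * char k t.

Lemma cintegrable_tpoly : cintegrable mu I (tpoly s c).
Proof.
have [] // := @cintegrable_sum _ _ _ mu I measurableI01 _ s (fun k t => c k * char k t).
by move=> k; apply: cintegrableZ => //; exact: cintegrable_char.
Qed.

Lemma inner_tpoly G : cintegrable mu I G ->
  cintegrable mu I (fun t => G t * (tpoly s c t)^*) /\
  cintegral mu I (fun t => G t * (tpoly s c t)^*) = \sum_(k <- s) (c k)^* * fcoef G k.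
Proof.
move=> iG.
have E t : G t * (tpoly s c t)^* = \sum_(k <- s) (c k)^* * (G t * (char k t)^*).
  rewrite /tpoly rmorph_sum mulr_sumr; apply: eq_bigr => k _.
  by rewrite rmorphM mulrCA.
have [i1 i2] := @cintegrable_sum _ _ _ mu I measurableI01 _ s
   (fun k t => (c k)^* * (G t * (char k t)^*))
   (fun k => cintegrableZ measurableI01 _ (cintegrable_charJ k iG)).
split; first by apply: eq_cintegrable i1 => // t _; rewrite E.
transitivity (cintegral mu I (fun t => \sum_(k <- s) (c k)^* * (G t * (char k t)^*))).
  by apply: eq_cintegral => t _; exact: E.
rewrite i2; apply: eq_bigr => k _; rewrite cintegralZ//.
exact: cintegrable_charJ.
Qed.

(** Orthonormality; the list s must be free of repetitions, whose coefficients
    would add up. *)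
Lemma fcoef_tpoly k : fcoef (tpoly s c) k = if k \in s then c k else 0.
Proof.
have E t : tpoly s c t * (char k t)^* = \sum_(j <- s) c j * (char j t * (char k t)^*).
  by rewrite /tpoly mulr_suml; apply: eq_bigr => j _; rewrite mulrA.
transitivity (cintegral mu I (fun t => \sum_(j <- s) c j * (char j t * (char k t)^*))).
  by apply: eq_cintegral => t _; exact: E.
have [_ ->] := @cintegrable_sum _ _ _ mu I measurableI01 _ s
   (fun j t => c j * (char j t * (char k t)^*))
   (fun j => cintegrableZ measurableI01 _ (cintegrable_charJ k (cintegrable_char j))).
transitivity (\sum_(j <- s) (if j == k then c k else 0)).
  apply: eq_bigr => j _; rewrite cintegralZ//; last exact/cintegrable_charJ/cintegrable_char.
  by rewrite -/(fcoef _ _) fcoef_char; case: eqP => [->|_]; rewrite ?mulr1 ?mulr0.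
rewrite -big_mkcond/=; case: ifPn => ks.
  by rewrite (big_rem k)//= eqxx big1_seq ?addr0// => j /andP[/eqP ->]; rewrite mem_rem_uniq// inE eqxx.
by rewrite big1_seq// => j /andP[/eqP -> js]; rewrite js in ks.
Qed.

Lemma sqnorm2_tpoly : sqnorm2 mu I (tpoly s c) = (\sum_(k <- s) sqnormc (c k))%:E.
Proof.
have [[i1 _] /(congr1 (@complex.Re R))] := inner_tpoly cintegrable_tpoly.
have -> : complex.Re (\sum_(k <- s) (c k)^* * fcoef (tpoly s c) k) =
    \sum_(k <- s) sqnormc (c k).
  rewrite raddf_sum; apply: eq_big_seq => k ks.
  by rewrite fcoef_tpoly ks mulrC sqnormc_mulJ.
move=> <-; rewrite /cintegral/= /Rintegral fineK; last exact: integrable_fin_num.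
by apply: eq_integral => t _; rewrite sqnormc_mulJ.
Qed.

(** Pythagoras: G - tpoly s c has vanishing coefficients on s, hence is orthogonal
    to tpoly s c. *)
Lemma sqnorm2_sub_tpoly G : cmeasurable_fun I G -> (sqnorm2 mu I G < +oo)%E ->
  (forall k, k \in s -> fcoef G k = c k) ->
  (sqnorm2 mu I (fun t => (G t - tpoly s c t)%R) + (\sum_(k <- s) sqnormc (c k))%:E =
   sqnorm2 mu I G)%E.
Proof.
move=> mG Gi cG; have iG := cintegrable01_sq mG Gi.
have [[i1 _] /(congr1 (@complex.Re R))] := inner_tpoly iG.
have -> : complex.Re (\sum_(k <- s) (c k)^* * fcoef G k) = \sum_(k <- s) sqnormc (c k).
  rewrite raddf_sum; apply: eq_big_seq => k ks.
  by rewrite cG// mulrC sqnormc_mulJ.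
move=> ipE.
have mp := cintegrable_measurable cintegrable_tpoly.
have Pi : (sqnorm2 mu I (tpoly s c) < +oo)%E by rewrite sqnorm2_tpoly ltry.
have := sqnorm2B measurableI01 mG mp Gi Pi; rewrite ipE sqnorm2_tpoly.
have finy : (sqnorm2 mu I G \is a fin_num) by rewrite ge0_fin_numE// sqnorm2_ge0.
rewrite -(fineK finy); move: (sqnorm2 _ _ _) => [r| |]//=.
by rewrite -!EFinD => -[H]; congr (_%:E); lra.
Qed.

Lemma bessel_seq G : cmeasurable_fun I G -> (sqnorm2 mu I G < +oo)%E ->
  (forall k, k \in s -> fcoef G k = c k) ->
  ((\sum_(k <- s) sqnormc (c k))%:E <= sqnorm2 mu I G)%E.
Proof.
move=> mG Gi cG; rewrite -(sqnorm2_sub_tpoly mG Gi cG) leeDr//.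
exact: sqnorm2_ge0.
Qed.

End trigonometric_polynomial.
End orthonormal_system.

(** * Symmetric sums over the integers and complex uniqueness *)

Section integer_sums.
Context {R : realType}.
Implicit Types (a : int -> \bar R) (n : nat) (k : int).

(** These are the frequencies summed over by [Theta_psum]. *)
Definition zrange n : seq int := [seq i%:Z - n%:Z | i <- iota 0 n.*2.+1].

Lemma mem_zrange n k : (k \in zrange n) = (`|k|%N <= n)%N.
Proof.
apply/mapP/idP => [ [i +] | kn].
  by rewrite mem_iota => ile ->; lia.
exists (absz (k + n%:Z)); last by lia.
by rewrite mem_iota; lia.
Qed.

Lemma zrange_uniq n : uniq (zrange n).
Proof. by rewrite map_inj_uniq ?iota_uniq// => i j; lia. Qed.

Lemma big_zrange (V : nmodType) (F : int -> V) n :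
  \sum_(i < n.*2.+1) F (i%:Z - n%:Z) = \sum_(k <- zrange n) F k.
Proof.
by rewrite /zrange big_map -[n.*2.+1 in RHS]subn0 -/(index_iota 0 _) big_mkord.
Qed.

Lemma zrange_sum_le (F : int -> \bar R) m n : (forall k, (0 <= F k)%E) ->
  (m <= n)%N -> (\sum_(k <- zrange m) F k <= \sum_(k <- zrange n) F k)%E.
Proof.
move=> F0 mn; rewrite (fsbig_seq _ _ (zrange_uniq m)) (fsbig_seq _ _ (zrange_uniq n)).
apply: lee_fsum_nneg_subset; rewrite ?finite_seq//.
  by move=> k; rewrite !inE /= !mem_zrange => /leq_trans; exact.
Qed.

(** Every finite set of integers lies in a symmetric range, so for nonnegative
    terms the symmetric partial sums exhaust the unordered sum. *)
Lemma cvg_zrange_esum a : (forall k, 0 <= a k)%E ->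
  (fun n => \sum_(k <- zrange n) a k)%E @ \oo --> \esum_(k in [set: int]) a k.
Proof.
move=> a0.
have nd : nondecreasing_seq (fun n => \sum_(k <- zrange n) a k)%E.
  by move=> m n mn; exact: zrange_sum_le.
rewrite (_ : \esum_(k in _) a k = ereal_sup (range (fun n => \sum_(k <- zrange n) a k)%E)).
  exact: ereal_nondecreasing_cvgn.
apply/eqP; rewrite eq_le; apply/andP; split.
  apply: ge_ereal_sup => _ [X [finX _] <-].
  have [n Xn] : exists n, X `<=` [set` zrange n].
    have /finite_seqP[s ->] := finX.
    exists (\max_(k <- s) absz k) => k /= ks; rewrite mem_zrange.
    by rewrite (big_rem k)//= leq_maxl.
  apply: (@le_trans _ _ (\sum_(k <- zrange n) a k)%E); last first.
    by apply: ereal_sup_ubound; exists n.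
  rewrite (fsbig_seq _ _ (zrange_uniq n)); apply: lee_fsum_nneg_subset => //.
  by move=> k; rewrite !inE => /Xn.
apply: ge_ereal_sup => _ [n _ <-]; apply: esum_ge; exists [set` zrange n].
  by split => //; exact: finite_seq.
by rewrite -(fsbig_seq _ _ (zrange_uniq n)).
Qed.

End integer_sums.

Section complex_uniqueness.
Context {R : realType}.
Local Notation mu := (@lebesgue_measure R).
Local Notation I := (`[0, 1[%classic : set (measurableTypeR R)).

(** Combining the coefficients at k and -k isolates the cosine and sine integrals
    of the real and of the imaginary part, to which the real uniqueness result
    applies. *)
Lemma fcoef_eq0 (G : R -> R[i]) : cintegrable mu I G ->
  (forall k, fcoef G k = 0) -> {ae mu, forall t, I t -> G t = 0}.
Proof.
move=> iG G0; have [i1 i2] := iG.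
have mc (k : int) (D : set R) : measurable_fun D (fun t : R => cos (2 * pi * k%:~R * t)).
    by apply: measurable_funTS; apply: continuous_measurable_fun => t;
      have := @continuous_cos_affine R (2 * pi * k%:~R) 0 t; under eq_fun do rewrite addr0.
have ms (k : int) (D : set R) : measurable_fun D (fun t : R => sin (2 * pi * k%:~R * t)).
    by apply: measurable_funTS; apply: continuous_measurable_fun => t;
      have := @continuous_sin_affine R (2 * pi * k%:~R) 0 t; under eq_fun do rewrite addr0.
have bc (k : int) (t : R) : I t -> `|cos (2 * pi * k%:~R * t)| <= 1 by move=> _; exact: cos_max.
have bs (k : int) (t : R) : I t -> `|sin (2 * pi * k%:~R * t)| <= 1 by move=> _; exact: sin_max.
have E k : fcoef G k =
  (\int[mu]_(t in I) (complex.Re (G t) * cos (2 * pi * k%:~R * t)) -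
   \int[mu]_(t in I) (complex.Im (G t) * sin (2 * pi * k%:~R * t))) +i*
  (\int[mu]_(t in I) (complex.Re (G t) * sin (2 * pi * k%:~R * t)) +
   \int[mu]_(t in I) (complex.Im (G t) * cos (2 * pi * k%:~R * t))).
  have := integrable_bounded_mul measurableI01 i1 (mc k I) (bc k).
  have := integrable_bounded_mul measurableI01 i1 (ms k I) (bs k).
  have := integrable_bounded_mul measurableI01 i2 (mc k I) (bc k).
  have := integrable_bounded_mul measurableI01 i2 (ms k I) (bs k).
  move=> i2s i2c i1s i1c.
  rewrite /fcoef /cintegral; congr (_ +i* _).
    rewrite -RintegralB//; apply: eq_Rintegral => t _.
    by rewrite /char expiRJ opprK cReM.
  rewrite -RintegralD//; apply: eq_Rintegral => t _.
  by rewrite /char expiRJ opprK cImM.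
have sE (h : R -> R) (k : int) : mu.-integrable I (fun t => (h t)%:E) ->
    \int[mu]_(t in I) (h t * sin (2 * pi * (- k)%:~R * t)) =
    - \int[mu]_(t in I) (h t * sin (2 * pi * k%:~R * t)).
  move=> ih; have ihs := integrable_bounded_mul measurableI01 ih (ms k I) (bs k).
  transitivity (\int[mu]_(t in I) (- 1 * (h t * sin (2 * pi * k%:~R * t)))).
    apply: eq_Rintegral => t _; rewrite mulrNz mulN1r -mulrN -sinN.
    by congr (_ * sin _); ring.
  by rewrite RintegralZl// mulN1r.
have cE (h : R -> R) (k : int) : \int[mu]_(t in I) (h t * cos (2 * pi * (- k)%:~R * t)) =
    \int[mu]_(t in I) (h t * cos (2 * pi * k%:~R * t)).
  apply: eq_Rintegral => t _; rewrite mulrNz -[in RHS]cosN.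
  by congr (_ * cos _); ring.
have H k : [/\ \int[mu]_(t in I) (complex.Re (G t) * cos (2 * pi * k%:~R * t)) = 0,
   \int[mu]_(t in I) (complex.Im (G t) * sin (2 * pi * k%:~R * t)) = 0,
   \int[mu]_(t in I) (complex.Re (G t) * sin (2 * pi * k%:~R * t)) = 0 &
   \int[mu]_(t in I) (complex.Im (G t) * cos (2 * pi * k%:~R * t)) = 0].
  have := E k; have := E (- k); rewrite !G0 !sE// !cE => -[e1 e2] [e3 e4].
  by split; lra.
have h1 := ae_eq0_of_coeffs i1 (fun k => let: And4 a _ _ _ := H k in a)
  (fun k => let: And4 _ _ a _ := H k in a).
have h2 := ae_eq0_of_coeffs i2 (fun k => let: And4 _ _ _ a := H k in a)
  (fun k => let: And4 _ a _ _ := H k in a).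
apply: ae_imply2 h1 h2 => t r0 z0 It.
by apply: eq_complexP; rewrite ?r0 ?z0.
Qed.
End complex_uniqueness.

(** * Fourier sums of square-summable sequences *)

Section convergence.
Context d (T : measurableType d) (R : realType).
Context (mu : {measure set T -> \bar R}) (D : set T) (mD : measurable D).

(** Fatou's lemma in the form used for L^2 limits: a bound on the integrals along
    the sequence passes to the almost everywhere limit. *)
Lemma fatou_le (f : nat -> T -> R) (g : T -> R) (M : nat -> \bar R) (L : \bar R) :
  (forall n, measurable_fun D (f n)) -> (forall n x, D x -> 0 <= f n x) ->
  measurable_fun D g -> (forall x, D x -> 0 <= g x) ->
  {ae mu, forall x, D x -> f ^~ x @ \oo --> g x} ->
  (forall n, \int[mu]_(x in D) (f n x)%:E <= M n)%E -> M @ \oo --> L ->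
  (\int[mu]_(x in D) (g x)%:E <= L)%E.
Proof.
move=> mf f0 mg g0 fg fM ML.
have mfE n : measurable_fun D (fun x => (f n x)%:E) by exact/measurable_EFinP.
apply: (@le_trans _ _ (\int[mu]_(x in D) limn_einf (fun n => (f n x)%:E))%E).
  rewrite le_eqVlt; apply/orP; left; apply/eqP.
  apply: ge0_ae_eq_integral => //.
  - exact/measurable_EFinP.
  - rewrite (_ : (fun _ => _) = (fun x => - limn_esup (fun n => - (f n x)%:E))%E); last first.
      by [].
    apply: measurableT_comp => //; apply: measurable_fun_limn_esup => // n.
    exact: measurableT_comp.
  - by move=> x Dx; rewrite limn_einf_lim; apply: lime_ge; [exact: is_cvg_einfs|];
      apply: nearW => n; apply: le_ereal_inf_tmp => _ [m _ <-]; rewrite lee_fin f0.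
  - apply: ae_imply fg => x fx Dx.
    have h : (f n x)%:E @[n --> \oo] --> (g x)%:E.
      by apply: cvg_EFin; [exact: nearW|exact: fx].
    by have [-> _] := cvg_limn_einf_sup h.
apply: (le_trans (fatou mu mD mfE _)); first by move=> n x Dx; rewrite lee_fin f0.
rewrite limn_einf_lim -(cvg_lim _ ML)//; apply: lee_lim.
- exact: is_cvg_einfs.
- by apply/cvg_ex; exists L.
- near=> n; apply: le_trans (fM n); apply: ereal_inf_lbound; exists n => //=.
Unshelve. all: by end_near. Qed.

(** By monotone convergence the sum of the |v n| is integrable, hence finite almost
    everywhere, which gives absolute convergence. *)
Lemma ae_cvg_series (v : nat -> T -> R) :
  (forall n, measurable_fun D (v n)) ->
  (\sum_(0 <= n <oo) \int[mu]_(x in D) `|v n x|%:E < +oo)%E ->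
  {ae mu, forall x, D x -> cvgn (series (v ^~ x))}.
Proof.
move=> mv vi.
have mav n : measurable_fun D (fun x => `|v n x|%:E).
  by apply/measurable_EFinP; exact: measurableT_comp.
have iv : mu.-integrable D (fun x => \sum_(0 <= n <oo) `|v n x|%:E)%E.
  apply/integrableP; split; first by apply: ge0_emeasurable_sum => // *; rewrite lee_fin.
  rewrite (eq_integral (fun x => \sum_(0 <= n <oo) `|v n x|%:E)%E); last first.
    by move=> x _; rewrite gee0_abs//; apply: nneseries_ge0 => *; rewrite lee_fin.
  by rewrite integral_nneseries// => n x _; rewrite lee_fin.
apply: ae_imply (integrable_ae mD iv) => x fx Dx.
apply: normed_cvg.
apply: nondecreasing_is_cvgn.
  by apply/nondecreasing_seqP => n; rewrite -subr_ge0 seriesSB normr_ge0.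
exists (fine (\sum_(0 <= n <oo) `|v n x|%:E)%E) => _ [n _ <-].
rewrite -lee_fin fineK; last exact: fx.
rewrite /series/= -sumEFin; apply: nneseries_lim_ge => k _.
by rewrite lee_fin.
Qed.

End convergence.

Section fourier_sum.
Context {R : realType}.
Local Notation mu := (@lebesgue_measure R).
Local Notation I := (`[0, 1[%classic : set (measurableTypeR R)).
Implicit Types (c : int -> R[i]) (n j : nat) (t : R).
Local Hint Resolve measurableI01 : core.

Definition energy c : \bar R := (\esum_(k in [set: int]) (sqnormc (c k))%:E)%E.

Definition partial_energy c n : R := \sum_(k <- zrange n) sqnormc (c k).

Definition tail c n : \bar R := (energy c - (partial_energy c n)%:E)%E.

(** The first rank whose tail is at most 4^-j. Along these ranks consecutive partial
    sums differ by a summable amount in L^1, which forces almost everywhere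
    convergence; and the ranks are determined by c, so that they vary
    measurably with it. The value 0 is for sequences of infinite energy. *)
Definition rapid_rank c j : nat :=
  if pselect (exists n, (tail c n <= (2^-1 ^+ j ^+ 2)%:E)%E) is left e
  then ex_minn e else 0%N.

(** The upper limit is used so that measurability does not depend on convergence. *)
Definition rlim (u : nat -> R) : R := fine (limn_esup (fun n => (u n)%:E)).

(** A representative of the sum of the Fourier series that is given everywhere by a
    formula in c and t. *)
Definition fsum c t : R[i] :=
  rlim (fun j => complex.Re (tpoly (zrange (rapid_rank c j)) c t)) +i*
  rlim (fun j => complex.Im (tpoly (zrange (rapid_rank c j)) c t)).

Lemma fsumD1 (c : int -> R[i]) t : fsum c (t + 1) = fsum c t.
Proof.
have e s : tpoly s c (t + 1) = tpoly s c t.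
  by apply: eq_bigr => k _; rewrite charD1.
by rewrite /fsum; congr (_ +i* _); congr rlim; apply/funext => j; rewrite e.
Qed.

Lemma rlimE (u : nat -> R) (l : R) : u @ \oo --> l -> rlim u = l.
Proof.
move=> ul; rewrite /rlim; have h : (u n)%:E @[n --> \oo] --> l%:E.
  by apply: cvg_EFin; [exact: nearW|exact: ul].
by have [_ ->] := cvg_limn_einf_sup h.
Qed.

Lemma partial_energy_nd c m n : (m <= n)%N ->
  partial_energy c m <= partial_energy c n.
Proof.
move=> mn; rewrite -lee_fin /partial_energy -!sumEFin.
by apply: zrange_sum_le => // k; rewrite lee_fin sqnormc_ge0.
Qed.

Lemma cvg_partial_energy c : (fun n => (partial_energy c n)%:E) @ \oo --> energy c.
Proof.
rewrite (_ : (fun n => _) = (fun n => \sum_(k <- zrange n) (sqnormc (c k))%:E)%E).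
  by apply: cvg_zrange_esum => k; rewrite lee_fin sqnormc_ge0.
by apply/funext => n; rewrite sumEFin.
Qed.

Lemma energy_ge0 c : (0 <= energy c)%E.
Proof. by apply: esum_ge0 => k _; rewrite lee_fin sqnormc_ge0. Qed.

Lemma energy_opp (c : int -> R[i]) : energy (fun k => c (- k)) = energy c.
Proof.
rewrite /energy [RHS](@reindex_esum _ _ _ setT setT (fun k : int => - k)) //.
Qed.

Lemma energy_shift (c : int -> R[i]) (j : int) : energy (fun k => c (k - j)) = energy c.
Proof.
rewrite /energy [RHS](@reindex_esum _ _ _ setT setT (fun k : int => k - j)) //.
split => //; first by move=> x y _ _ /addIr.
by move=> x _; exists (x + j) => //; rewrite addrK.
Qed.

Lemma energyZ (w : R) (c e : int -> R[i]) :
  (forall k, sqnormc (e k) = w * sqnormc (c k)) -> energy e = (w%:E * energy c)%E.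
Proof.
move=> ec; apply: cvg_unique (@cvg_partial_energy e) _ => //.
rewrite (_ : (fun n => _) = (fun n => w%:E * (partial_energy c n)%:E)%E).
  by apply: cvgeZl => //; exact: cvg_partial_energy.
apply/funext => n; rewrite -EFinM /partial_energy mulr_sumr.
by congr (_%:E); apply: eq_bigr => k _.
Qed.

Lemma partial_energy_le c n : ((partial_energy c n)%:E <= energy c)%E.
Proof.
have h := @cvg_partial_energy c; rewrite -(cvg_lim _ h)//.
apply: lime_ge; first by apply/cvg_ex; exists (energy c).
by near=> m; rewrite lee_fin; apply: partial_energy_nd; near: m; exact: nbhs_infty_ge.
Unshelve. all: by end_near. Qed.

(** The squared distance between two partial sums is the energy of the
    coefficients between the two ranks. *)
Lemma sqnorm2_tpolyB c m n : (m <= n)%N ->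
  sqnorm2 mu I (fun t => tpoly (zrange n) c t - tpoly (zrange m) c t) =
  (partial_energy c n - partial_energy c m)%:E.
Proof.
move=> mn; have un := zrange_uniq n; have um := zrange_uniq m.
have mp := cintegrable_measurable (cintegrable_tpoly (zrange n) c).
have := @sqnorm2_sub_tpoly R _ um c (tpoly (zrange n) c) mp.
rewrite sqnorm2_tpoly// ltry => /(_ isT) h.
have {h} : (sqnorm2 mu I (fun t => (tpoly (zrange n) c t - tpoly (zrange m) c t)%R) +
   (partial_energy c m)%:E = (partial_energy c n)%:E)%E.
  apply: h => k km; rewrite fcoef_tpoly// ifT//.
  by move: km; rewrite !mem_zrange => /leq_trans; exact.
move: (sqnorm2 _ _ _) => [r| |]//= [rE].
by congr (_%:E); rewrite -rE addrK.
Qed.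

Lemma sqnorm2_tpolyB_le c m n (e : R) : (energy c < +oo)%E -> (tail c m <= e%:E)%E ->
  (tail c n <= e%:E)%E ->
  (sqnorm2 mu I (fun t => (tpoly (zrange n) c t - tpoly (zrange m) c t)%R) <= e%:E)%E.
Proof.
move=> ci tm tn.
have tl p q : (tail c p <= e%:E)%E -> partial_energy c q - partial_energy c p <= e.
  rewrite /tail; have := partial_energy_le c q.
  move: ci (energy_ge0 c); case: (energy c) => [r| |]//= _ _.
  by rewrite !lee_fin => h1 h2; apply: le_trans h2; rewrite lerD2r.
have [mn|/ltnW nm] := leqP m n.
  by rewrite sqnorm2_tpolyB// lee_fin; exact: tl.
rewrite (eq_sqnorm2 mu (g := fun t => (-1) * (tpoly (zrange m) c t - tpoly (zrange n) c t))); last first.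
  by move=> t _; rewrite mulN1r opprB.
rewrite sqnorm2Z//; last first.
  apply: cmeasurableD; last apply: cmeasurableN;
    exact: (cintegrable_measurable (cintegrable_tpoly _ c)).
by rewrite sqnormcN sqnormcC expr1n mul1e sqnorm2_tpolyB// lee_fin; exact: tl.
Qed.

Lemma cvg_tail c : (energy c < +oo)%E -> tail c @ \oo --> 0%E.
Proof.
move=> ci; have cf : energy c \is a fin_num by rewrite ge0_fin_numE// energy_ge0.
rewrite -(subee cf); apply: cvgeB => //.
- by rewrite fin_num_adde_defl// fin_numN.
- exact: cvg_cst.
- exact: cvg_partial_energy.
Qed.

Lemma tail_ge0 c n : (energy c < +oo)%E -> (0 <= tail c n)%E.
Proof. by move=> ci; rewrite /tail sube_ge0 ?fin_numE// partial_energy_le. Qed.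

Lemma rapid_rankP c j : (energy c < +oo)%E ->
  (tail c (rapid_rank c j) <= (2^-1 ^+ j ^+ 2)%:E)%E.
Proof.
move=> ci; rewrite /rapid_rank; case: pselect => [e|]; first by case: ex_minnP.
case.
have e0 : 0 < 2^-1 ^+ j ^+ 2 :> R by rewrite !exprn_gt0// invr_gt0.
have := cvg_tail ci; move/fine_cvgP => [fint].
move/cvgrPdist_le => /(_ _ e0) h.
have [n _ tn] : \forall n \near \oo, (tail c n <= (2^-1 ^+ j ^+ 2)%:E)%E.
  apply: filterS2 fint h => n fn; rewrite /= sub0r normrN => h.
  by rewrite -(fineK fn) lee_fin; apply: le_trans h; exact: ler_norm.
by exists n; apply: tn => /=.
Qed.

(** The successive differences have L^2 norm at most 2^-j. The weighted inequality
    with weight 2^-j turns this into an L^1 bound by 2 * 2^-j, and the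
    telescoping series converges almost everywhere. *)
Lemma ae_cvg_rapid c : (energy c < +oo)%E ->
  {ae mu, forall t, I t ->
   (cvgn (fun j => complex.Re (tpoly (zrange (rapid_rank c j)) c t)) /\
   cvgn (fun j => complex.Im (tpoly (zrange (rapid_rank c j)) c t)))}.
Proof.
move=> ci; pose u j t := tpoly (zrange (rapid_rank c j)) c t.
have iu j : cintegrable mu I (u j) by exact: cintegrable_tpoly.
have mu_ j : cmeasurable_fun I (u j) by exact: (cintegrable_measurable (iu j)).
have mv j : cmeasurable_fun I (fun t => u j.+1 t - u j t).
  by apply: cmeasurableD => //; exact: cmeasurableN.
have bound (f : R[i] -> R) :
   (forall z w : R[i], f (z - w) = f z - f w) ->
   (forall j, measurable_fun I (fun t => f (u j t))) ->
   (forall (e : R) (z : R[i]), 0 < e -> `|f z| <= e^-1 * sqnormc z + e) ->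
   {ae mu, forall t, I t -> cvgn (fun j => f (u j t))}.
  move=> fB mf fe.
  have mfv j : measurable_fun I (fun t => f (u j.+1 t) - f (u j t)).
    exact: measurable_funB.
  have : {ae mu, forall t, I t -> cvgn (series (fun j => f (u j.+1 t) - f (u j t)))}.
    apply: (ae_cvg_series measurableI01 mfv).
    apply: (@le_lt_trans _ _ (\sum_(0 <= j <oo | xpredT j) (4 / (2 ^ j.+1)%:R)%:E)%E); last first.
      by apply: le_lt_trans (epsilon_trick0 _ _) _ => //; exact: ltry.
    apply: lee_nneseries => [j _ _|j _]; first by apply: integral_ge0 => t _; rewrite lee_fin.
    have e0 : 0 < 2^-1 ^+ j :> R by rewrite exprn_gt0// invr_gt0.
    (* the weight that balances the two terms of e^-1 e^2 + e *)
    set e := 2^-1 ^+ j in e0 *.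
    have t1 : (tail c (rapid_rank c j.+1) <= (e ^+ 2)%:E)%E.
      apply: (le_trans (rapid_rankP _ ci)); rewrite lee_fin lerXn2r ?nnegrE ?exprn_ge0//.
      by rewrite exprS ler_piMl ?(ltW e0)//; lra.
    have t2 := sqnorm2_tpolyB_le ci (rapid_rankP j ci) t1.
    have msq := measurable_sqnormc (mv j).
    apply: (@le_trans _ _ (\int[mu]_(t in I) ((e^-1)%:E * (sqnormc (u j.+1 t - u j t))%:E + e%:E))%E).
      apply: ge0_le_integral => //.
      - by apply/measurable_EFinP; exact: measurableT_comp.
      - apply: emeasurable_funD; last exact: measurable_cst.
        by apply: emeasurable_funM; [exact: measurable_cst|exact/measurable_EFinP].
      - by move=> t _; rewrite -EFinM -EFinD lee_fin -fB; exact: fe.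
    rewrite ge0_integralD//; last 3 first.
    - by move=> t _; rewrite mule_ge0// lee_fin ?invr_ge0 ?sqnormc_ge0// ltW.
    - by apply: emeasurable_funM; [exact: measurable_cst|exact/measurable_EFinP].
    - by move=> t _; rewrite lee_fin ltW.
    rewrite ge0_integralZl//; last 3 first.
    - exact/measurable_EFinP.
    - by move=> t _; rewrite lee_fin sqnormc_ge0.
    - by rewrite lee_fin invr_ge0 ltW.
    rewrite integral_cst// [X in (_ + _ * X)%E](_ : _ = 1%E); last exact: measure01.
    rewrite mule1.
    apply: (@le_trans _ _ ((e^-1)%:E * (e ^+ 2)%:E + e%:E)%E).
      by rewrite leeD2r// lee_wpmul2l// lee_fin invr_ge0 ltW.
    rewrite -EFinM -EFinD lee_fin le_eqVlt; apply/orP; left; apply/eqP.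
    rewrite /e natrX exprVn [2 ^+ j.+1]exprS.
    have : 2 ^+ j != 0 :> R by rewrite expf_neq0.
    by move: (2 ^+ j) => x x0; field.
  apply: ae_imply => t + It => /(_ It) h.
  rewrite (_ : (fun j => f (u j t)) = (fun j => f (u 0%N t) + series (fun j => f (u j.+1 t) - f (u j t)) j)).
    exact: (is_cvgD (is_cvg_cst _) h).
  by apply/funext => j; rewrite /series/= telescope_sumr// addrC subrK.
have r : {ae mu, forall t, I t -> cvgn (fun j => complex.Re (u j t))}.
  apply: bound => [z w|j|e z e0]; first by rewrite cReD cReN.
    by have [] := mu_ j.
  by have := abs_Re_mul_le_eps z 1 e0; rewrite !mulr1 sqnormcC expr1n mulr1.
have i : {ae mu, forall t, I t -> cvgn (fun j => complex.Im (u j t))}.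
  apply: bound => [z w|j|e z e0]; first by rewrite cImD cImN.
    by have [] := mu_ j.
  by have := abs_Re_mul_le_eps z (- 'i%C) e0; rewrite cReMNi sqnormcNi mulr1.
by apply: ae_imply2 r i => t h1 h2 It; split; [exact: h1|exact: h2].
Qed.

End fourier_sum.

(** * Riesz-Fischer and Parseval on [0, 1) *)

Section fourier_series.
Context {R : realType}.
Local Notation mu := (@lebesgue_measure R).
Local Notation I := (`[0, 1[%classic : set (measurableTypeR R)).
Implicit Types (c : int -> R[i]) (n j : nat) (t : R).
Local Hint Resolve measurableI01 : core.

Lemma measurable_rlim d (T : measurableType d) (D : set T) (f : nat -> T -> R) :
  (forall n, measurable_fun D (f n)) ->
  measurable_fun D (fun x => rlim (fun n => f n x)).
Proof.
move=> mf; apply: (measurableT_comp (f := fine)) => //.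
by apply: measurable_fun_limn_esup => n; exact/measurable_EFinP.
Qed.

Lemma measurable_fsum c : cmeasurable_fun I (fsum c).
Proof.
have H j := cintegrable_measurable (cintegrable_tpoly (zrange (rapid_rank c j)) c).
by split; apply: measurable_rlim => j; case: (H j).
Qed.

Lemma measurable_tpoly s c : cmeasurable_fun I (tpoly s c).
Proof. exact: cintegrable_measurable (cintegrable_tpoly _ _). Qed.

(** Apply Fatou to the distances from the n-th partial sum to the partial sums of
    ranks [rapid_rank c j], which converge almost everywhere to [fsum c]. *)
Lemma riesz_fischer c n : (energy c < +oo)%E ->
  (sqnorm2 mu I (fun t => (tpoly (zrange n) c t - fsum c t)%R) <= tail c n)%E.
Proof.
move=> ci; pose u j t := tpoly (zrange (rapid_rank c j)) c t.
have tn : tail c n \is a fin_num.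
  by rewrite fin_numB ge0_fin_numE ?energy_ge0// ci.
have tn0 := tail_ge0 n ci.
have e0 j : 0 <= 2^-1 ^+ j ^+ 2 :> R by rewrite !exprn_ge0// invr_ge0.
apply: (@fatou_le _ _ _ mu I measurableI01
  (fun j t => sqnormc (tpoly (zrange n) c t - u j t))
  (fun t => sqnormc (tpoly (zrange n) c t - fsum c t))
  (fun j => (fine (tail c n) + 2^-1 ^+ j ^+ 2)%:E)) => //.
- move=> j; apply: measurable_sqnormc; apply: cmeasurableD; first exact: measurable_tpoly.
  by apply: cmeasurableN; exact: measurable_tpoly.
- by move=> j t _; exact: sqnormc_ge0.
- apply: measurable_sqnormc; apply: cmeasurableD; first exact: measurable_tpoly.
  by apply: cmeasurableN; exact: measurable_fsum.
- by move=> t _; exact: sqnormc_ge0.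
- apply: ae_imply (ae_cvg_rapid ci) => t h It; have [h1 h2] := h It.
  under eq_fun do rewrite sqnormcE cReD cReN cImD cImN.
  rewrite sqnormcE cReD cReN cImD cImN /fsum/=.
  have r1 := rlimE h1; have r2 := rlimE h2.
  apply: cvgD; apply: cvgM; (apply: cvgB; first exact: cvg_cst);
    by rewrite ?r1 ?r2.
- move=> j; apply: sqnorm2_tpolyB_le => //.
  + apply: (le_trans (rapid_rankP j ci)).
    by rewrite lee_fin lerDr fine_ge0.
  + by rewrite -[leLHS]fineK// lee_fin lerDl.
- rewrite -[X in _ --> X]fineK//; apply: cvg_EFin; first exact: nearW.
  rewrite -[X in _ --> X]addr0; apply: cvgD; first exact: cvg_cst.
  under eq_fun do rewrite /= -exprM mulnC exprM.
  apply: cvg_expr.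
  rewrite ger0_norm ?exprn_ge0 ?invr_ge0//.
  by rewrite expr2; lra.
Qed.

(** The k-th coefficient of a partial sum of rank at least |k| is c k, and by Bessel
    for the single index k it differs from that of G by at most the L^2
    distance. *)
Lemma fcoef_of_cvg c (G : R -> R[i]) : cmeasurable_fun I G ->
  (fun n => sqnorm2 mu I (fun t => tpoly (zrange n) c t - G t)) @ \oo --> 0%E ->
  (sqnorm2 mu I G < +oo)%E /\ forall k, fcoef G k = c k.
Proof.
move=> mG Gc.
have mSG n : cmeasurable_fun I (fun t => tpoly (zrange n) c t - G t).
  by apply: cmeasurableD; [exact: measurable_tpoly|exact: cmeasurableN].
have small (e : R) : 0 < e -> \forall n \near \oo,
    (sqnorm2 mu I (fun t => (tpoly (zrange n) c t - G t)%R) <= e%:E)%E.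
  move=> e0; move/fine_cvgP : (Gc) => [fin /cvgrPdist_le /(_ _ e0)].
  apply: filterS2 fin => n fn; rewrite /= sub0r normrN => h.
  by rewrite -(fineK fn) lee_fin; apply: le_trans h; exact: ler_norm.
have Pi n : (sqnorm2 mu I (tpoly (zrange n) c) < +oo)%E.
  by rewrite sqnorm2_tpoly ?zrange_uniq// ltry.
have Gi : (sqnorm2 mu I G < +oo)%E.
  have [n _ /(_ n (leqnn n)) h] := small 1 ltr01.
  rewrite (eq_sqnorm2 mu (g := fun t => tpoly (zrange n) c t + (-1) * (tpoly (zrange n) c t - G t))); last first.
    by move=> t _; rewrite mulN1r opprB addrC subrK.
  apply: sqnorm2D_lty => //.
  - exact: measurable_tpoly.
  - by apply: cmeasurableM => //; exact: cmeasurable_cst.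
  - rewrite sqnorm2Z// sqnormcN sqnormcC expr1n mul1e.
    exact: le_lt_trans h (ltry _).
split => // k.
apply/eqP; rewrite -subr_eq0; apply/eqP; apply: sqnormc_eq0.
apply/eqP; rewrite eq_le sqnormc_ge0 andbT.
apply/ler_addgt0Pr => e e0; rewrite add0r.
have [n _ h] := small e e0.
pose m := maxn n (absz k).
rewrite -lee_fin; apply: le_trans (h m _); last by rewrite /= leq_maxl.
have SGi : (sqnorm2 mu I (fun t => (tpoly (zrange m) c t - G t)%R) < +oo)%E.
  by apply: le_lt_trans (h m _) (ltry _); rewrite /= leq_maxl.
have := @bessel_seq R [:: k] isT (fun _ => c k - fcoef G k) _ (mSG m) SGi.
rewrite big_seq1 -(sqnormcN (c k - _)) opprB; apply.
move=> j; rewrite inE => /eqP ->.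
rewrite /fcoef.
transitivity (cintegral mu I (fun t => tpoly (zrange m) c t * (char k t)^* + (- 1) * (G t * (char k t)^*))).
  by apply: eq_cintegral => t _; rewrite mulN1r mulrBl.
have iG := cintegrable01_sq mG Gi.
rewrite cintegralD//; last 2 first.
- exact/cintegrable_charJ/cintegrable_tpoly.
- exact/cintegrableZ/cintegrable_charJ.
rewrite cintegralZ//; last exact: cintegrable_charJ.
rewrite mulN1r -/(fcoef _ _) -/(fcoef _ _) fcoef_tpoly ?zrange_uniq// mem_zrange.
by rewrite /m leq_maxr.
Qed.

Lemma cvg_fsum c : (energy c < +oo)%E ->
  (fun n => sqnorm2 mu I (fun t => tpoly (zrange n) c t - fsum c t)) @ \oo --> 0%E.
Proof.
move=> ci; apply: (squeeze_cvge _ (cvg_cst 0%E) (cvg_tail ci)).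
by near=> n; rewrite sqnorm2_ge0 riesz_fischer.
Unshelve. all: by end_near. Qed.

Lemma bessel (G : R -> R[i]) : cmeasurable_fun I G -> (sqnorm2 mu I G < +oo)%E ->
  (energy (fcoef G) <= sqnorm2 mu I G)%E.
Proof.
move=> mG Gi; have h := @cvg_partial_energy R (fcoef G).
rewrite -(cvg_lim _ h)//; apply: lime_le; first by apply/cvg_ex; exists (energy (fcoef G)).
by apply: nearW => n; apply: bessel_seq => //; exact: zrange_uniq.
Qed.

(** The function G is only integrable, and both sides may be infinite. If the energy
    of its coefficients is finite, then [fsum] has the same coefficients as G,
    so it equals G almost everywhere by uniqueness in L^1, and G is square
    integrable after all. *)
Lemma parseval (G : R -> R[i]) : cintegrable mu I G ->
  energy (fcoef G) = sqnorm2 mu I G.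
Proof.
move=> iG; have mG := cintegrable_measurable iG.
apply/eqP; rewrite eq_le; apply/andP; split.
  have [Gi|] := ltP (sqnorm2 mu I G) +oo%E; first exact: bessel.
  by rewrite leye_eq => /eqP ->; exact: leey.
have [ci|] := ltP (energy (fcoef G)) +oo%E; last first.
  by rewrite leye_eq => /eqP ->; exact: leey.
set c := fcoef G in ci *.
have [Fi Fc] := fcoef_of_cvg (measurable_fsum c) (cvg_fsum ci).
have iF := cintegrable01_sq (measurable_fsum c) Fi.
have GF : {ae mu, forall t, I t -> G t + (-1) * fsum c t = 0}.
  apply: fcoef_eq0; first by apply: cintegrableD => //; exact: cintegrableZ.
  move=> k; rewrite /fcoef.
  transitivity (cintegral mu I (fun t => G t * (char k t)^* + (-1) * (fsum c t * (char k t)^*))).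
    by apply: eq_cintegral => t _; rewrite mulrDl mulrA.
  rewrite cintegralD//; last 2 first.
  - exact: cintegrable_charJ.
  - exact/cintegrableZ/cintegrable_charJ.
  rewrite cintegralZ//; last exact: cintegrable_charJ.
  by rewrite mulN1r -/(fcoef _ _) -/(fcoef _ _) Fc subrr.
have -> : sqnorm2 mu I G = sqnorm2 mu I (fsum c).
  apply: ge0_ae_eq_integral => //.
  - by apply/measurable_EFinP; exact: measurable_sqnormc.
  - by apply/measurable_EFinP; apply: measurable_sqnormc; exact: measurable_fsum.
  - by move=> t _; rewrite lee_fin sqnormc_ge0.
  - by move=> t _; rewrite lee_fin sqnormc_ge0.
  - apply: ae_imply GF => t h It; have /eqP := h It.
    by rewrite mulN1r subr_eq0 => /eqP ->.
(* letting n tend to infinity in the Pythagorean identity for partial sums *)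
have un n := zrange_uniq n.
have E n : (sqnorm2 mu I (fun t => (fsum c t - tpoly (zrange n) c t)%R) + (partial_energy c n)%:E =
    sqnorm2 mu I (fsum c))%E.
  by apply: sqnorm2_sub_tpoly => //; exact: measurable_fsum.
have h : (fun n => (tail c n + (partial_energy c n)%:E)%E) @ \oo --> (0 + energy c)%E.
  apply: cvgeD; [|exact: cvg_tail|exact: cvg_partial_energy].
  by rewrite fin_num_adde_defr.
rewrite add0e in h; rewrite -(cvg_lim _ h)//; apply: lime_ge.
  by apply/cvg_ex; exists (energy c).
apply: nearW => n; rewrite -(E n) leeD2r//.
apply: le_trans (riesz_fischer n ci).
rewrite (eq_sqnorm2 mu (g := fun t => (-1) * (tpoly (zrange n) c t - fsum c t))); last first.
  by move=> t _; rewrite mulN1r opprB.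
rewrite sqnorm2Z//; last first.
  apply: cmeasurableD; first exact: measurable_tpoly.
  by apply: cmeasurableN; exact: measurable_fsum.
by rewrite sqnormcN sqnormcC expr1n mul1e.
Qed.

End fourier_series.

(** * Joint measurability of Fourier sums *)

Section measurable_selection.
Context d (T : measurableType d) (D : set T) (mD : measurable D).

(** The level sets of the selector N are countably many, and on each of them the
    function is one of the measurable functions f k. *)
Lemma measurable_select (K : countType) d' (U : sigmaRingType d') (N : T -> K)
    (f : K -> T -> U) :
  (forall n, measurable (D `&` [set x | N x = n])) ->
  (forall n, measurable_fun D (f n)) -> measurable_fun D (fun x => f (N x) x).
Proof.
move=> mN mf _ B mB.
rewrite (_ : _ `&` _ =
    \bigcup_(n in [set: K]) ((D `&` [set x | N x = n]) `&` (D `&` f n @^-1` B))).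
  apply: countable_bigcupT_measurable => // n.
  by apply: measurableI => //; exact: mf.
apply/seteqP; split => [x [Dx Bx]|x [n _ [[Dx Nx] [_ Bx]]]].
  by exists (N x).
by split => //=; rewrite Nx.
Qed.

End measurable_selection.

Section joint_measurability.
Context d (T : measurableType d) (R : realType) (D : set T) (mD : measurable D).
Variables (c : T -> int -> R[i]).
Hypothesis mc : forall k, cmeasurable_fun D (c ^~ k).

Lemma measurable_tail n : measurable_fun D (fun x => tail (c x) n).
Proof.
have mp m : measurable_fun D (fun x => (partial_energy (c x) m)%:E).
  rewrite /partial_energy; apply/measurable_EFinP.
  by apply: measurable_sum => k; apply: measurable_sqnormc; exact: mc.
apply: emeasurable_funB => //.
apply: (emeasurable_fun_cvg (fun m x => (partial_energy (c x) m)%:E)) => //.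
by move=> x _; exact: cvg_partial_energy.
Qed.

(** A description by countably many conditions on tails, each of them measurable
    in a parameter. *)
Lemma rapid_rankE (e : int -> R[i]) j n : rapid_rank e j = n <->
  ((tail e n <= (2^-1 ^+ j ^+ 2)%:E)%E \/
    n = 0%N /\ forall m, ~ (tail e m <= (2^-1 ^+ j ^+ 2)%:E)%E) /\
  forall m, (m < n)%N -> ~ (tail e m <= (2^-1 ^+ j ^+ 2)%:E)%E.
Proof.
rewrite /rapid_rank; case: pselect => [ex|nex].
  case: ex_minnP => m tm minm; split => [<-|[[tn|[n0 none]] less]].
  - split; first by left.
    by move=> p pm tp; have := minm p tp; rewrite leqNgt pm.
  - apply/eqP; rewrite eqn_leq minm//= leqNgt.
    by apply/negP => mn; apply: (less m).
  - by have := none m.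
split => [<-|[[tn|[-> //]] _]].
  by split => //; right; split => // m tm; apply: nex; exists m.
by exfalso; apply: nex; exists n.
Qed.

Lemma measurable_rapid_rank j n :
  measurable (D `&` [set x | rapid_rank (c x) j = n]).
Proof.
have mt m : measurable (D `&` [set x | (tail (c x) m <= (2^-1 ^+ j ^+ 2)%:E)%E]).
  by apply: emeasurable_fun_infty_c => //; exact: measurable_tail.
have mnt m : measurable (D `&` [set x | ~ (tail (c x) m <= (2^-1 ^+ j ^+ 2)%:E)%E]).
  rewrite (_ : _ `&` _ = D `\` (D `&` [set x | (tail (c x) m <= (2^-1 ^+ j ^+ 2)%:E)%E])).
    exact: measurableD.
  by apply/seteqP; split => x [Dx h]; split => //; [case|move=> ?; apply: h].
have mall (p : pred nat) :
    measurable (D `&` [set x | forall m, p m -> ~ (tail (c x) m <= (2^-1 ^+ j ^+ 2)%:E)%E]).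
  rewrite (_ : _ `&` _ = \bigcap_m (if p m
     then D `&` [set x | ~ (tail (c x) m <= (2^-1 ^+ j ^+ 2)%:E)%E] else D)).
    by apply: bigcapT_measurable => m; case: ifP.
  apply/seteqP; split => [x [Dx h] m _|x h].
    by case: ifPn => // pm; split => //; exact: h.
  split => [|m pm]; first by have := h 0%N I; case: ifP => // _ [].
  by have := h m I; rewrite pm => -[].
rewrite (_ : _ `&` _ =
  ((D `&` [set x | (tail (c x) n <= (2^-1 ^+ j ^+ 2)%:E)%E]) `|`
   (if n == 0%N then D `&` [set x | forall m, xpredT m -> ~ (tail (c x) m <= (2^-1 ^+ j ^+ 2)%:E)%E] else set0)) `&`
  (D `&` [set x | forall m, (m < n)%N -> ~ (tail (c x) m <= (2^-1 ^+ j ^+ 2)%:E)%E])).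
  apply: measurableI; last exact: (mall (fun m => (m < n)%N)).
  apply: measurableU => //; case: ifP => _ //; exact: (mall xpredT).
apply/seteqP; split => x.
  move=> [Dx /= /rapid_rankE [h1 h2]]; split; last by split.
  case: h1 => [h1|[n0 h1]]; [by left|right].
  by rewrite n0 eqxx; split => // m _; exact: h1.
move=> [h1 [Dx h2]]; split => //=; apply/rapid_rankE; split => //.
case: h1 => [[_ h1]|]; first by left.
by case: eqP => // -> [_ h1]; right; split => // m; exact: h1.
Qed.

Local Notation P := (T * measurableTypeR R)%type.

(** For a fixed rank the partial sum is visibly measurable in (x, xi); the rank is
    a measurable selector in x, and upper limits preserve measurability. *)
Lemma measurable_fsum_joint :
  cmeasurable_fun (D `*` setT : set P) (fun p => fsum (c p.1) p.2).
Proof.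
have mDT : measurable (D `*` setT : set P) by exact: measurableX.
have mS s : cmeasurable_fun (D `*` setT : set P) (fun p => tpoly s (c p.1) p.2).
  apply: cmeasurable_sum => k; apply: cmeasurableM.
    by apply: (cmeasurable_fst setT mD (h := c ^~ k)); exact: mc.
  apply: cmeasurable_expiR; apply: measurable_funTS.
  apply: measurableT_comp => //; apply: measurable_funM => //.
have mN j n : measurable ((D `*` setT : set P) `&` [set p | rapid_rank (c p.1) j = n]).
  rewrite (_ : _ `&` _ = (D `&` [set x | rapid_rank (c x) j = n]) `*` setT).
    by apply: measurableX => //; exact: measurable_rapid_rank.
  by apply/seteqP; split => [[x t] [[Dx _] h]|[x t] [[Dx h] _]].
split; apply: measurable_rlim => j.
  apply: (measurable_select mDT (fun n => mN j n)
    (f := fun n p => complex.Re (tpoly (zrange n) (c p.1) p.2))) => n.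
  by have [] := mS (zrange n).
apply: (measurable_select mDT (fun n => mN j n)
  (f := fun n p => complex.Im (tpoly (zrange n) (c p.1) p.2))) => n.
by have [] := mS (zrange n).
Qed.

End joint_measurability.

(** * Affine changes of variable and Parseval on an interval *)

Section affine_change_of_variable.
Context {R : realType}.
Local Notation mu := (@lebesgue_measure R).
Local Notation mR := (measurableTypeR R).
Implicit Types (s b : R).

Definition affine s b : mR -> mR := fun t => b + s * t.

Lemma measurable_affine s b : measurable_fun setT (affine s b).
Proof.
apply: measurable_funD; first exact: measurable_cst.
by apply: measurable_funM => //.
Qed.

(** Lebesgue measure is determined by its values on intervals. *)
Lemma lebesgue_measure_affine s b (A : set mR) : 0 < s -> measurable A ->
  (mu A = s%:E * pushforward mu (affine s b) A)%E.
Proof.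
move=> s0 mA; pose k : {nonneg R} := NngNum (ltW s0).
pose nu0 := mscale k (pushforward mu (affine s b)) : {measure set mR -> \bar R}.
pose nu := nu0 (measurable_affine s b).
suff -> : mu A = nu A by [].
apply: lebesgue_measure_unique => //= _ [[x y]] _ <-.
rewrite /nu /nu0/= /mscale/= /pushforward.
have -> : affine s b @^-1` `]x, y] = `](x - b) / s, (y - b) / s]%classic.
  apply/seteqP; split => t; rewrite /affine/= !in_itv/=;
    by rewrite ltr_pdivrMr// ler_pdivlMr// ltrBlDl lerBrDl mulrC.
rewrite !lebesgue_measure_itv/= !lte_fin ltr_pM2r ?invr_gt0// ltrD2r.
case: ifP => _; last by rewrite mule0.
by rewrite -!EFinB -EFinM; congr (_%:E); field; rewrite gt_eqF.
Qed.

Lemma ge0_integral_affine s b (D : set mR) (f : R -> \bar R) : 0 < s ->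
  measurable D -> measurable_fun D f -> (forall x, D x -> 0 <= f x)%E ->
  (\int[mu]_(x in D) f x =
   s%:E * \int[mu]_(t in affine s b @^-1` D) f (b + s * t)%R)%E.
Proof.
move=> s0 mD mf f0; pose k : {nonneg R} := NngNum (ltW s0).
pose nu0 := mscale k (pushforward mu (affine s b)) : {measure set mR -> \bar R}.
pose nu := nu0 (measurable_affine s b).
transitivity (\int[nu]_(x in D) f x)%E.
  by apply: eq_measure_integral => A mA _; exact: lebesgue_measure_affine.
rewrite /nu /nu0 ge0_integral_mscale//; congr (_ * _)%E.
rewrite ge0_integral_pushforward//; first exact: measurable_affine.
by move=> x; rewrite inE; exact: f0.
Qed.

Lemma measurable_comp_affine s b (D : set mR) d' (U : sigmaRingType d') (f : R -> U) :
  measurable D -> measurable_fun D f ->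
  measurable_fun (affine s b @^-1` D) (fun t => f (b + s * t)).
Proof.
move=> mD mf; apply: (measurable_comp (F := D)) => //.
- by move=> _ [t Dt <-].
- by apply: measurable_funTS; exact: measurable_affine.
Qed.

Lemma integrable_affine s b (D : set mR) (f : R -> R) : 0 < s -> measurable D ->
  mu.-integrable D (fun x => (f x)%:E) ->
  mu.-integrable (affine s b @^-1` D) (fun t => (f (b + s * t))%:E) /\
  \int[mu]_(x in D) f x = s * \int[mu]_(t in affine s b @^-1` D) f (b + s * t).
Proof.
move=> s0 mD /integrableP[mf fi].
have mf' := @measurable_comp_affine s b D _ _ (fun x => (f x)%:E) mD mf.
have mA : measurable (affine s b @^-1` D).
  by rewrite -[_ @^-1` _]setTI; exact: measurable_affine.
have fi' : mu.-integrable (affine s b @^-1` D) (fun t => (f (b + s * t))%:E).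
  apply/integrableP; split => //.
  move: fi; rewrite (ge0_integral_affine b s0 mD)//; last exact: measurableT_comp.
  set X := (\int[mu]_(t in affine s b @^-1` D) `|(f (b + s * t)%R)%:E|)%E.
  rewrite -/X; case: X => [r _||_//]; [exact: ltry|by rewrite gt0_muley ?lte_fin].
split => //; rewrite /Rintegral integralE [in RHS]integralE.
rewrite (ge0_integral_affine b s0 mD)//; last exact: measurable_funepos.
rewrite [X in fine (_ - X) = _](ge0_integral_affine b s0 mD)//; last exact: measurable_funeneg.
have pf := integrable_pos_fin_num mA fi'.
have qf := integrable_neg_fin_num mA fi'.
pose p := (\int[mu]_(t in affine s b @^-1` D) (fun t => (f (b + s * t)%R)%:E)^\+ t)%E.
pose q := (\int[mu]_(t in affine s b @^-1` D) (fun t => (f (b + s * t)%R)%:E)^\- t)%E.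
rewrite [X in (s%:E * X - _)%E](_ : _ = p); last by apply: eq_integral => t _; rewrite !funeposE.
rewrite [X in (_ - s%:E * X)%E](_ : _ = q); last by apply: eq_integral => t _; rewrite !funenegE.
rewrite -/p -/q.
rewrite -(fineK (pf : p \is a fin_num)) -(fineK (qf : q \is a fin_num)).
by rewrite -!EFinM -!EFinB /= mulrBr.
Qed.

Lemma ae_affine s b (P : R -> Prop) : 0 < s ->
  {ae mu, forall x, P x} -> {ae mu, forall t, P (b + s * t)}.
Proof.
move=> s0 [N [mN N0 PN]]; exists (affine s b @^-1` N); split.
- by rewrite -[_ @^-1` _]setTI; exact: measurable_affine.
- have := lebesgue_measure_affine b s0 mN; rewrite [X in X = _]N0 /pushforward.
  by move=> /esym/eqP; rewrite mule_eq0 eqe gt_eqF//= => /eqP.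
- by move=> t /= Pt; apply: PN.
Qed.

End affine_change_of_variable.

Section parseval_interval.
Context {R : realType}.
Local Notation mu := (@lebesgue_measure R).
Local Notation mR := (measurableTypeR R).
Local Notation I := (`[0, 1[%classic : set mR).

Lemma cintegral_affine (s b : R) (D : set mR) (f : R -> R[i]) : 0 < s -> measurable D ->
  cintegrable mu D f ->
  cintegrable mu (affine s b @^-1` D) (fun t => f (b + s * t)) /\
  cintegral mu D f = s%:C * cintegral mu (affine s b @^-1` D) (fun t => f (b + s * t)).
Proof.
move=> s0 mD [f1 f2].
have [i1 e1] := integrable_affine b s0 mD f1.
have [i2 e2] := integrable_affine b s0 mD f2.
split; first by split.
apply: eq_complexP; rewrite ?cReM ?cImM /=.
  by rewrite e1 mul0r subr0.
by rewrite e2 mul0r addr0.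
Qed.

Lemma affine_preimage_co (s b : R) : 0 < s -> affine s b @^-1` `[b, b + s[ = I.
Proof.
move=> s0; apply/seteqP; split => t; rewrite /affine/= !in_itv/=.
  by rewrite lerDl ltrD2l pmulr_rge0// gtr_pMr.
by rewrite lerDl ltrD2l pmulr_rge0// gtr_pMr.
Qed.

(** Substituting x = b + s t turns the k-th exponential of the interval into
    sqrt(s)^-1 times a constant of modulus 1 times the conjugate of
    char (- k); the factors of s add up to the Jacobian. *)
Lemma parseval_itv (s b : R) (G : R -> R[i]) : 0 < s ->
  cintegrable mu (`[b, b + s[%classic : set mR) G ->
  energy (fun k => cintegral mu (`[b, b + s[%classic : set mR)
     (fun x => G x * (((Num.sqrt s)^-1)%:C * expiR (2 * pi * k%:~R * x / s))^*)) =
  sqnorm2 mu (`[b, b + s[%classic : set mR) G.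
Proof.
move=> s0; set J := `[b, b + s[%classic : set mR; move=> iG.
have mJ : measurable J by exact: measurable_itv.
have JE : affine s b @^-1` J = I by exact: affine_preimage_co.
have [iGT _] := cintegral_affine b s0 mJ iG; rewrite JE in iGT.
pose GT t := G (b + s * t).
have sn : s != 0 by rewrite gt_eqF.
have ss0 : Num.sqrt s != 0 by rewrite sqrtr_eq0 -ltNge.
have E (k : int) : cintegral mu J
   (fun x => G x * (((Num.sqrt s)^-1)%:C * expiR (2 * pi * k%:~R * x / s))^*) =
   (Num.sqrt s)%:C * expiR (- (2 * pi * k%:~R * b / s)) * fcoef GT (- k).
  have iGE : cintegrable mu J
    (fun x => G x * (((Num.sqrt s)^-1)%:C * expiR (2 * pi * k%:~R * x / s))^*).
    apply: (@cintegrableM_bounded _ _ _ mu J mJ G _ (s^-1)) => //.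
      apply: cmeasurableJ; apply: cmeasurableM; first exact: cmeasurable_cst.
      apply: cmeasurable_expiR; apply: measurable_funTS.
      apply: measurable_funM => //; exact: mulrl_measurable.
    move=> x _; rewrite sqnormcJ sqnormcM sqnormcC sqnormc_expiR mulr1.
    by rewrite exprVn sqr_sqrtr// ltW.
  have [_ ->] := cintegral_affine b s0 mJ iGE; rewrite JE.
  rewrite /fcoef.
  transitivity (s%:C * cintegral mu I (fun t =>
    (((Num.sqrt s)^-1)%:C * expiR (- (2 * pi * k%:~R * b / s))) * (GT t * (char (- k) t)^*))).
    congr (_ * _); apply: eq_cintegral => t _.
    rewrite conj_scaled_expiR.
    rewrite /GT /char expiRJ opprK.
    rewrite (_ : - (2 * pi * k%:~R * (b + s * t) / s) =
      - (2 * pi * k%:~R * b / s) + 2 * pi * (- k)%:~R * t); last first.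
      by rewrite mulrNz; field.
    by rewrite expiRD; ring.
  rewrite cintegralZ//; last exact: cintegrable_charJ.
  rewrite !mulrA; congr (_ * _ * _).
  rewrite -rmorphM; congr (_%:C).
  by rewrite -{1}(sqr_sqrtr (ltW s0)) expr2 mulfK.
transitivity (s%:E * energy (fcoef GT))%E.
  rewrite -energy_opp; apply: energyZ => k.
  rewrite E opprK !sqnormcM sqnormc_expiR mulr1 sqnormcC sqr_sqrtr//.
  exact: ltW.
rewrite parseval// /sqnorm2 (ge0_integral_affine b s0 mJ).
- by rewrite JE.
- have := measurable_sqnormc (cintegrable_measurable iG).
  by move=> /measurable_EFinP.
- by move=> x _; rewrite lee_fin sqnormc_ge0.
Qed.
End parseval_interval.

(** * The tiling of the half-line by dilates of [1, a) *)

Section tonelli_int.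
Context d (T : measurableType d) (R : realType).
Context (mu : {measure set T -> \bar R}) (D : set T) (mD : measurable D).
Variable g : int -> T -> \bar R.
Hypothesis mg : forall k, measurable_fun D (g k).
Hypothesis g0 : forall k x, D x -> (0 <= g k x)%E.

Let cvg_at x : D x ->
  (fun n => \sum_(k <- zrange n) g k x)%E @ \oo --> \esum_(k in [set: int]) g k x.
Proof. by move=> Dx; apply: cvg_zrange_esum => k; exact: g0. Qed.

Lemma measurable_esum_int : measurable_fun D (fun x => \esum_(k in [set: int]) g k x).
Proof.
apply: (emeasurable_fun_cvg (fun n x => \sum_(k <- zrange n) g k x)%E).
  by move=> n; exact: emeasurable_sum.
exact: cvg_at.
Qed.

(** Monotone convergence along the symmetric partial sums. *)
Lemma integral_esum_int :
  (\int[mu]_(x in D) (\esum_(k in [set: int]) g k x) =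
   \esum_(k in [set: int]) (\int[mu]_(x in D) g k x))%E.
Proof.
have h : (fun n => \int[mu]_(x in D) \sum_(k <- zrange n) g k x)%E @ \oo -->
    (\int[mu]_(x in D) limn (fun n => \sum_(k <- zrange n) g k x))%E.
  apply: cvg_monotone_convergence => //.
  - by move=> n; exact: emeasurable_sum.
  - by move=> n x Dx; apply: sume_ge0 => k _; exact: g0.
  - by move=> x Dx m n mn; apply: zrange_sum_le => // k; exact: g0.
rewrite -(@eq_integral _ _ _ mu D _ (fun x => \esum_(k in [set: int]) g k x)) in h; last first.
  by move=> x; rewrite inE => Dx; apply/esym/cvg_lim => //; exact: cvg_at.
apply: cvg_unique h _ => //.
rewrite (_ : (fun n => _) = (fun n => \sum_(k <- zrange n) \int[mu]_(x in D) g k x)%E).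
  by apply: cvg_zrange_esum => k; apply: integral_ge0 => x Dx; exact: g0.
by apply/funext => n; rewrite ge0_integral_sum// => k x Dx; exact: g0.
Qed.

End tonelli_int.

Section dilation_blocks.
Context {R : realType}.
Local Notation mu := (@lebesgue_measure R).
Local Notation mR := (measurableTypeR R).
Variables (a : R) (a1 : 1 < a).
Local Notation J := (`[1, a[%classic : set mR).
Local Notation Rp := (@Rpos R : set mR).

Let a0 : 0 < a. Proof. exact: lt_trans a1. Qed.
Let lna0 : 0 < ln a. Proof. by rewrite ln_gt0. Qed.

Lemma measurable_comp_scale (s : R) (D : set mR) d' (U : sigmaRingType d') (f : R -> U) :
  measurable D -> measurable_fun D f ->
  measurable_fun (affine s 0 @^-1` D) (fun t => f (s * t)).
Proof.
move=> mD mf; have := @measurable_comp_affine R s 0 D _ _ f mD mf.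
by apply: eq_measurable_fun => t _; rewrite add0r.
Qed.

(** The index of the tile [a^k, a^(k+1)) containing x, as in
    [dilation_periodize]. *)
Definition level (x : R) : int := Num.floor (ln x / ln a).

Lemma expaz_gt0 (k : int) : 0 < a ^ k.
Proof. exact: exprz_gt0. Qed.

Lemma ln_expz (k : int) : ln (a ^ k) = k%:~R * ln a.
Proof.
case: k => n; first by rewrite -exprnP lnXn// -mulr_natl.
by rewrite NegzE mulrNz mulNr -exprnN lnV ?posrE ?exprn_gt0// lnXn// -mulr_natl.
Qed.

Lemma levelE (x : R) (k : int) : 0 < x -> (a ^ k <= x < a ^ (k + 1)) = (level x == k).
Proof.
move=> x0; rewrite -ler_ln ?posrE ?expaz_gt0// -ltr_ln ?posrE ?expaz_gt0//.
rewrite !ln_expz -ler_pdivlMr// -ltr_pdivrMr//.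
apply/idP/eqP => [h|<-]; first exact: floor_def.
exact: floor_itv.
Qed.

Lemma levelM (x : R) (k : int) : 1 <= x < a -> level (a ^ k * x) = k.
Proof.
move=> /andP[x1 xa]; have x0 : 0 < x by apply: lt_le_trans x1.
apply/eqP; rewrite -levelE ?mulr_gt0 ?expaz_gt0//.
rewrite ler_peMr ?(ltW (expaz_gt0 k))//=.
by rewrite expfzDr ?gt_eqF// expr1z ltr_pM2l ?expaz_gt0.
Qed.

Definition block (k : int) : set mR := `[a ^ k, a ^ (k + 1)[%classic.

Lemma measurable_block k : measurable (block k).
Proof. exact: measurable_itv. Qed.

Lemma block_Rpos k : block k `<=` Rp.
Proof.
move=> x; rewrite /block /Rpos/= !in_itv/= andbT => /andP[h _].
by apply: lt_le_trans h; exact: expaz_gt0.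
Qed.

Lemma measurable_Rpos : measurable Rp.
Proof. exact: measurable_itv. Qed.

Lemma affine_preimage_block k : affine (a ^ k) 0 @^-1` block k = J.
Proof.
have ak := expaz_gt0 k.
apply/seteqP; split => t; rewrite /block /affine/= !in_itv/= add0r;
  by rewrite expfzDr ?gt_eqF// expr1z ltr_pM2l// ler_pMr.
Qed.

(** Cut the half-line into tiles, and map each tile back to [1, a). *)
Lemma integral_dilation (h : R -> \bar R) : measurable_fun Rp h ->
  (forall x, Rp x -> 0 <= h x)%E ->
  (\int[mu]_(x in Rp) h x =
   \int[mu]_(t in J) (\esum_(k in [set: int]) ((a ^ k)%R%:E * h (a ^ k * t)%R)))%E.
Proof.
move=> mh h0; have mRp := measurable_Rpos.
have mJ : measurable J by exact: measurable_itv.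
have mhb k : measurable_fun Rp (h \_ (block k)).
  apply/measurable_restrict => //; first exact: measurable_block.
  by apply: measurable_funS mh => // x [].
transitivity (\int[mu]_(x in Rp) (\esum_(k in [set: int]) (h \_ (block k)) x))%E.
  apply: eq_integral => x; rewrite inE => Rx.
  have x0 : 0 < x by move: Rx; rewrite /Rpos/= in_itv/= andbT.
  rewrite -[LHS](@esum_set1 _ _ (level x) (fun=> h x)); last exact: h0.
  rewrite esum_mkcond; apply: eq_esum => k _.
  rewrite /patch (_ : (x \in block k) = (k \in [set level x]))//.
  apply/idP/idP; rewrite !inE /block/= in_itv/= levelE//; first by move/eqP.
  by move=> ->.
rewrite integral_esum_int//; last first.
  by move=> k x Rx; rewrite /patch; case: ifP => // _; exact: h0.
have aJ k t : J t -> Rp (a ^ k * t).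
  rewrite /Rpos/= !in_itv/= andbT => /andP[t1 _].
  by rewrite mulr_gt0 ?expaz_gt0// (lt_le_trans ltr01).
have mhJ k : measurable_fun J (fun t => h (a ^ k * t)).
  rewrite -(affine_preimage_block k); apply: measurable_comp_scale; first exact: measurable_block.
  by apply: measurable_funS mh => //; exact: block_Rpos.
rewrite integral_esum_int//; last 2 first.
- by move=> k; apply: emeasurable_funM => //; exact: measurable_cst.
- move=> k t Jt; rewrite mule_ge0 ?lee_fin ?(ltW (expaz_gt0 k))//; apply: h0.
  exact: aJ.
apply: eq_esum => k _.
rewrite -integral_mkcondr setIidr; last exact: block_Rpos.
rewrite (ge0_integral_affine 0 (expaz_gt0 k) (measurable_block k)); last 2 first.
- by apply: measurable_funS mh => //; exact: block_Rpos.
- by move=> x bx; apply: h0; exact: block_Rpos bx.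
rewrite affine_preimage_block ge0_integralZl ?lee_fin ?(ltW (expaz_gt0 k))//; last first.
  by move=> t Jt; apply: h0; exact: aJ.
by congr (_ * _)%E; apply: eq_integral => t _; rewrite add0r.
Qed.

(** For fixed x these are the coefficients of the series defining Theta f (x, .). *)
Definition dilation_coef (f : R -> R[i]) (x : R) (k : int) : R[i] :=
  (a `^ (k%:~R / 2))%:C * f (a ^ k * x).

Lemma powRa_sqr k : (a `^ (k%:~R / 2)) ^+ 2 = a ^ k.
Proof.
rewrite -powR_mulrn ?powR_ge0// -powRrM divfK// powR_intmul//.
exact: ltW.
Qed.

Lemma sqnormc_dilation_coef f x k :
  sqnormc (dilation_coef f x k) = a ^ k * sqnormc (f (a ^ k * x)).
Proof. by rewrite sqnormcM sqnormcC powRa_sqr. Qed.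

Lemma sqnorm2_Rpos f : cmeasurable_fun Rp f ->
  sqnorm2 mu Rp f = (\int[mu]_(x in J) energy (dilation_coef f x))%E.
Proof.
move=> mf; rewrite /sqnorm2 integral_dilation.
- apply: eq_integral => x _; apply: eq_esum => k _.
  by rewrite sqnormc_dilation_coef EFinM.
- by apply/measurable_EFinP; exact: measurable_sqnormc.
- by move=> x _; rewrite lee_fin sqnormc_ge0.
Qed.

Lemma cmeasurable_scale (f : R -> R[i]) k : cmeasurable_fun Rp f ->
  cmeasurable_fun Rp (fun x => f (a ^ k * x)).
Proof.
move=> [m1 m2].
have pre : affine (a ^ k) 0 @^-1` Rp = Rp.
  apply/seteqP; split => t; rewrite /affine /Rpos/= !in_itv/= !andbT add0r;
    by rewrite pmulr_rgt0// expaz_gt0.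
have H (p : R -> R) : measurable_fun Rp p -> measurable_fun Rp (fun x => p (a ^ k * x)).
  by move=> mp; rewrite -pre; apply: measurable_comp_scale => //; exact: measurable_Rpos.
split; [exact: (H (fun x => complex.Re (f x)))|exact: (H (fun x => complex.Im (f x)))].
Qed.

Lemma measurable_dilation_coef (f : R -> R[i]) k : cmeasurable_fun Rp f ->
  cmeasurable_fun Rp (fun x => dilation_coef f x k).
Proof.
move=> mf; apply: cmeasurableM; first exact: cmeasurable_cst.
exact: cmeasurable_scale.
Qed.

Lemma measurable_level k : measurable (Rp `&` [set x | level x = k]).
Proof.
rewrite (_ : _ `&` _ = block k); first exact: measurable_block.
apply/seteqP; split => x.
  move=> [Rx /= <-]; rewrite /block/= in_itv/= levelE//.
  by move: Rx; rewrite /Rpos/= in_itv/= andbT.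
move=> bx; have Rx := block_Rpos bx; split => //=.
apply/eqP; rewrite -levelE; first by move: bx; rewrite /block/= in_itv.
by move: Rx; rewrite /Rpos/= in_itv/= andbT.
Qed.

End dilation_blocks.

(** * Parseval on a strip *)

Section complex_fubini.
Context d1 d2 (T1 : measurableType d1) (T2 : measurableType d2) (R : realType).
Context (m1 : {sigma_finite_measure set T1 -> \bar R}).
Context (m2 : {sigma_finite_measure set T2 -> \bar R}).
Context (A : set T1) (B : set T2) (mA : measurable A) (mB : measurable B).

Lemma cfubini_rect (H : T1 * T2 -> R[i]) :
  cintegrable (m1 \x m2)%E (A `*` B) H ->
  [/\ {ae m1, forall x, A x -> cintegrable m2 B (fun y => H (x, y))},
      cintegrable m1 A (fun x => cintegral m2 B (fun y => H (x, y))) &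
      cintegral (m1 \x m2)%E (A `*` B) H =
      cintegral m1 A (fun x => cintegral m2 B (fun y => H (x, y)))].
Proof.
move=> [h1 h2].
have [a1 i1 e1] := fubini_rect mA mB h1; have [a2 i2 e2] := fubini_rect mA mB h2.
split; [|by split|by rewrite /cintegral e1 e2].
by apply: ae_imply2 a1 a2 => x k1 k2 Ax; split; [exact: k1|exact: k2].
Qed.

End complex_fubini.

Section sections_on_strip.
Context {R : realType}.
Local Notation mu := (@lebesgue_measure R).
Local Notation mR := (measurableTypeR R).
Local Notation I := (`[0, 1[%classic : set mR).
Local Notation leb := (@leb2 R).
Local Hint Resolve measurableI01 : core.
Variables (J : set mR) (mJ : measurable J).
Local Notation Q := (J `*` I : set (plane R)).

Lemma sqnorm2_strip (F : plane R -> R[i]) : cmeasurable_fun Q F ->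
  sqnorm2 leb Q F = (\int[mu]_(x in J) sqnorm2 mu I (fun xi => F (x, xi)))%E /\
  measurable_fun J (fun x => sqnorm2 mu I (fun xi => F (x, xi))).
Proof.
move=> mF.
have mF2 : measurable_fun Q (fun p => (sqnormc (F p))%:E).
  by apply/measurable_EFinP; exact: measurable_sqnormc.
have [] := @tonelli_rect _ _ mR mR R mu mu J I mJ measurableI01 _ mF2.
  by move=> p _; rewrite lee_fin sqnormc_ge0.
by move=> m1 m2; split.
Qed.

End sections_on_strip.

Section parseval_strip.
Context {R : realType}.
Local Notation mu := (@lebesgue_measure R).
Local Notation mR := (measurableTypeR R).
Local Notation I := (`[0, 1[%classic : set mR).
Local Notation leb := (@leb2 R).
Local Hint Resolve measurableI01 : core.
Variables (s b : R) (s0 : 0 < s).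
Local Notation J := (`[b, b + s[%classic : set mR).
Local Notation Q := (J `*` I : set (plane R)).
Local Notation E m x := (((Num.sqrt s)^-1)%:C * expiR (2 * pi * m%:~R * x / s) : R[i]).

Let mJ : measurable J. Proof. exact: measurable_itv. Qed.
Let mQ : measurable Q. Proof. exact: measurableX. Qed.

(** Apply Parseval in x to each coefficient h j of the slices of H, sum over j
    under the integral, and apply Parseval in xi to almost every slice. Both
    steps are for integrable functions; h j in particular need not be square
    integrable. *)
Lemma parseval_strip (H : plane R -> R[i]) : cintegrable leb Q H ->
  (\esum_(mj in [set: int * int])
    (sqnormc (cintegral leb Q
       (fun p => H p * (E mj.1 p.1 * char mj.2 p.2)^*)))%:E)%E = sqnorm2 leb Q H.
Proof.
move=> iH.
have mH := cintegrable_measurable iH.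
have mE0 (D : set mR) m : cmeasurable_fun D (fun x => E m x).
  apply: cmeasurableM; first exact: cmeasurable_cst.
  apply: cmeasurable_expiR; apply: measurable_funTS.
  apply: measurable_funM => //; exact: mulrl_measurable.
have mE m : cmeasurable_fun Q (fun p => E m p.1).
  by apply: (cmeasurable_fst I mJ (h := fun x => E m x)); exact: mE0.
have mc j : cmeasurable_fun Q (fun p => char j p.2).
  by apply: (cmeasurable_snd J measurableI01 (h := char j)); exact: measurable_char.
have sE m x : sqnormc (E m x) = s^-1.
  by rewrite sqnormcM sqnormcC sqnormc_expiR mulr1 exprVn sqr_sqrtr// ltW.
have iHc j : cintegrable leb Q (fun p => H p * (char j p.2)^*).
  apply: (@cintegrableM_bounded _ _ _ leb Q mQ H _ 1) => //.
    exact: cmeasurableJ.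
  by move=> p _; rewrite sqnormcJ sqnormc_char.
have iHEc m j : cintegrable leb Q (fun p => H p * (E m p.1 * char j p.2)^*).
  apply: (@cintegrableM_bounded _ _ _ leb Q mQ H _ s^-1) => //.
    by apply: cmeasurableJ; exact: cmeasurableM.
  by move=> p _; rewrite sqnormcJ sqnormcM sE sqnormc_char mulr1.
have [aeH _ _] := cfubini_rect mJ measurableI01 iH.
pose h j x := fcoef (fun xi => H (x, xi)) j.
have ih j : cintegrable mu J (h j).
  by have [_ + _] := cfubini_rect mJ measurableI01 (iHc j).
have coefE m j : cintegral leb Q (fun p => H p * (E m p.1 * char j p.2)^*) =
    cintegral mu J (fun x => h j x * (E m x)^*).
  have [_ i1 ->] := cfubini_rect mJ measurableI01 (iHEc m j).
  apply: (ae_eq_cintegral mJ (cintegrable_measurable i1)).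
    apply: cmeasurableM; first exact: (cintegrable_measurable (ih j)).
    by apply: cmeasurableJ; exact: mE0.
  apply: ae_imply aeH => x iHx Jx.
  rewrite /h /fcoef [RHS]mulrC -cintegralZ//; last exact/cintegrable_charJ/iHx.
  apply: eq_cintegral => xi _ /=.
  by rewrite rmorphM; ring.
transitivity (\esum_(j in [set: int]) (\esum_(m in [set: int])
   (sqnormc (cintegral mu J (fun x => h j x * (E m x)^*)))%:E))%E.
  rewrite (esum_esum (J := fun=> setT)); last by move=> *; rewrite lee_fin sqnormc_ge0.
  rewrite (@reindex_esum _ _ _ ([set: int] `*`` fun=> [set: int]) setT (fun p => (p.2, p.1))).
    by apply: eq_esum => -[j m] _ /=; rewrite coefE.
  split => //.
    by move=> [x y] [x' y'] _ _ [-> ->].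
  by move=> [x y] _; exists (y, x).
transitivity (\esum_(j in [set: int]) (sqnorm2 mu J (h j)))%E.
  by apply: eq_esum => j _; exact: parseval_itv.
rewrite /sqnorm2 -(@integral_esum_int _ _ _ mu J mJ (fun j x => (sqnormc (h j x))%:E)); last 2 first.
- by move=> j; apply/measurable_EFinP/measurable_sqnormc/cintegrable_measurable/ih.
- by move=> j x _; rewrite lee_fin sqnormc_ge0.
rewrite -[RHS]/(sqnorm2 leb Q H); have [-> ms] := sqnorm2_strip mJ mH.
apply: ge0_ae_eq_integral => //.
- apply: measurable_esum_int => //.
  + by move=> j; apply/measurable_EFinP/measurable_sqnormc/cintegrable_measurable/ih.
  + by move=> j x _; rewrite lee_fin sqnormc_ge0.
- by move=> x _; apply: esum_ge0 => j _; rewrite lee_fin sqnormc_ge0.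
- by move=> x _; exact: sqnorm2_ge0.
- apply: ae_imply aeH => x iHx Jx.
  exact: (parseval (iHx Jx)).
Qed.

End parseval_strip.

(** * The transform as an isometry *)

Section zak.
Context {R : realType}.
Local Notation mu := (@lebesgue_measure R).
Local Notation mR := (measurableTypeR R).
Local Notation I := (`[0, 1[%classic : set mR).
Local Notation leb := (@leb2 R).
Local Hint Resolve measurableI01 : core.
Variables (a : R) (a1 : 1 < a).
Local Notation J := (`[1, a[%classic : set mR).
Local Notation Rp := (@Rpos R : set mR).
Local Notation Q := (J `*` I : set (plane R)).
Implicit Types (f g : R -> R[i]) (F G P : plane R -> R[i]) (m j k : int).

Let a0 : 0 < a. Proof. exact: lt_trans a1. Qed.
Let mJ : measurable J. Proof. exact: measurable_itv. Qed.
Let mRp : measurable Rp. Proof. exact: measurable_Rpos. Qed.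
Let mQ : measurable Q. Proof. exact: measurableX. Qed.
Let JRp : J `<=` Rp.
Proof.
by move=> x; rewrite /Rpos/= !in_itv/= andbT => /andP[h _]; apply: lt_le_trans h.
Qed.

(** A weak form of [is_Theta] on the fundamental domain Q: only the Fourier
    coefficients of the slices are prescribed. It is stable under linear
    operations, modulation and dilation, where convergence of partial sums
    would have to be reproved each time. *)
Definition is_Zak f F : Prop :=
  cmeasurable_fun Q F /\
  {ae mu, forall x, J x -> cintegrable mu I (fun xi => F (x, xi)) /\
     forall k, fcoef (fun xi => F (x, xi)) k = dilation_coef a f x k}.

(** Rescale all tiles to [1, a), then apply Parseval to almost every slice. *)
Lemma Zak_isometry f F : cmeasurable_fun Rp f -> is_Zak f F ->
  sqnorm2 mu Rp f = sqnorm2 leb Q F.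
Proof.
move=> mf [mF fF]; rewrite (sqnorm2_Rpos a1 mf).
have [-> ms] := sqnorm2_strip mJ mF.
have mc k : measurable_fun J (fun x => (sqnormc (dilation_coef a f x k))%:E).
  apply/measurable_EFinP/measurable_sqnormc.
  exact: (cmeasurable_funS mRp JRp (measurable_dilation_coef a1 k mf)).
apply: ge0_ae_eq_integral => //.
- by apply: measurable_esum_int => // k x _; rewrite lee_fin sqnormc_ge0.
- by move=> x _; exact: energy_ge0.
- by move=> x _; exact: sqnorm2_ge0.
- apply: ae_imply fF => x h Jx; have [iF cF] := h Jx.
  rewrite -(parseval iF); apply: eq_esum => k _.
  by rewrite cF.
Qed.

Lemma ZakZ (z : R[i]) f F : is_Zak f F -> is_Zak (fun x => z * f x) (fun p => z * F p).
Proof.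
move=> [mF fF]; split; first by apply: cmeasurableM => //; exact: cmeasurable_cst.
apply: ae_imply fF => x h Jx; have [iF cF] := h Jx; split.
  exact: cintegrableZ.
move=> k; rewrite /fcoef.
transitivity (cintegral mu I (fun xi => z * (F (x, xi) * (char k xi)^*))).
  by apply: eq_cintegral => xi _; rewrite mulrA.
rewrite cintegralZ//; last exact: cintegrable_charJ.
by rewrite -/(fcoef _ _) cF /dilation_coef mulrCA.
Qed.

Lemma ZakD f F g G : is_Zak f F -> is_Zak g G ->
  is_Zak (fun x => f x + g x) (fun p => F p + G p).
Proof.
move=> [mF fF] [mG gG]; split; first exact: cmeasurableD.
apply: ae_imply2 fF gG => x h1 h2 Jx.
have [iF cF] := h1 Jx; have [iG cG] := h2 Jx; split; first exact: cintegrableD.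
move=> k; rewrite /fcoef.
transitivity (cintegral mu I (fun xi => F (x, xi) * (char k xi)^* + G (x, xi) * (char k xi)^*)).
  by apply: eq_cintegral => xi _; rewrite mulrDl.
rewrite cintegralD//; [|exact: cintegrable_charJ..].
by rewrite -/(fcoef _ _) -/(fcoef _ _) cF cG /dilation_coef mulrDr.
Qed.

(** Polarisation expresses the real part through norms, which are preserved. *)
Let Zak_Re f g F G : inL2 Rp f -> inL2 Rp g -> is_Zak f F -> is_Zak g G ->
  complex.Re (innerL2 Rp f g) = complex.Re (cintegral leb Q (fun p => F p * (G p)^*)).
Proof.
move=> [mf fi] [mg gi] ZF ZG; have [mF _] := ZF; have [mG _] := ZG.
have {}fi : (sqnorm2 mu Rp f < +oo)%E := fi.
have {}gi : (sqnorm2 mu Rp g < +oo)%E := gi.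
have nf := Zak_isometry mf ZF; have ng := Zak_isometry mg ZG.
have h1 := sqnorm2B mRp mf mg fi gi.
have Fi : (sqnorm2 leb Q F < +oo)%E by rewrite -nf.
have Gi : (sqnorm2 leb Q G < +oo)%E by rewrite -ng.
have h2 := sqnorm2B mQ mF mG Fi Gi.
have {h2} := etrans h1 (etrans (congr2 adde nf ng) (esym h2)).
have ZN : is_Zak (fun x => f x - g x) (fun p => F p - G p).
  have := ZakD ZF (ZakZ (-1) ZG).
  rewrite (_ : (fun x => f x + -1 * g x) = (fun x => f x - g x)); last first.
    by apply/funext => x; rewrite mulN1r.
  by rewrite (_ : (fun p => F p + -1 * G p) = (fun p => F p - G p))//;
    apply/funext => p; rewrite mulN1r.
have mfg : cmeasurable_fun Rp (fun x => f x - g x) by exact/cmeasurableD/cmeasurableN.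
have nfg := Zak_isometry mfg ZN.
have fgi : (sqnorm2 mu Rp (fun x => (f x - g x)%R) < +oo)%E.
  apply: (sqnorm2D_lty mRp) => //; first exact: cmeasurableN.
  by rewrite /sqnorm2; under eq_integral do rewrite sqnormcN.
have fin : (sqnorm2 mu Rp (fun x => (f x - g x)%R) \is a fin_num).
  by rewrite ge0_fin_numE// sqnorm2_ge0.
move=> e; have {e} := etrans e (congr1 (fun z => z + _)%E (esym nfg)).
rewrite -(fineK fin) -!EFinD => -[] /addrI h.
apply: (@mulfI _ 2) => //; exact: h.
Qed.

Lemma Zak_inner f g F G : inL2 Rp f -> inL2 Rp g -> is_Zak f F -> is_Zak g G ->
  innerL2 Rp f g = cintegral leb Q (fun p => F p * (G p)^*).
Proof.
move=> Lf Lg ZF ZG; apply: eq_complexP; first exact: Zak_Re.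
(* the imaginary part is the real part of the pairing with i * g *)
have [mf fi] := Lf; have [mg gi] := Lg; have [mF _] := ZF; have [mG _] := ZG.
have Lig : inL2 Rp (fun x => 'i%C * g x).
  split; first by apply: cmeasurableM => //; exact: cmeasurable_cst.
  change (sqnorm2 mu Rp (fun x => ('i%C * g x)%R) < +oo)%E.
  rewrite (sqnorm2Z _ mRp)// -sqnormcN sqnormcNi mul1e.
  exact: gi.
have iE (z w : R[i]) : z * ('i%C * w)^* = (- 'i%C) * (z * w^*).
  by apply: eq_complexP; rewrite !(cReM, cImM, cReJ, cImJ, cReN, cImN)/=; ring.
have ifg := cintegrable_mul2 mRp mf mg fi gi.
have Fi : (sqnorm2 leb Q F < +oo)%E by rewrite -(Zak_isometry mf ZF); exact: fi.
have Gi : (sqnorm2 leb Q G < +oo)%E by rewrite -(Zak_isometry mg ZG); exact: gi.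
have iFG := cintegrable_mul2 mQ mF mG Fi Gi.
have h1 : innerL2 Rp f (fun x => 'i%C * g x) = (- 'i%C) * innerL2 Rp f g.
  rewrite /innerL2 -(cintegralZ mRp)//; apply: eq_cintegral => x _; exact: iE.
have h2 : cintegral leb Q (fun p => F p * ('i%C * G p)^*) =
    (- 'i%C) * cintegral leb Q (fun p => F p * (G p)^*).
  rewrite -(cintegralZ mQ)//; apply: eq_cintegral => p _; exact: iE.
by have := Zak_Re Lf Lig ZF (ZakZ 'i%C ZG); rewrite h1 h2 ![- 'i%C * _]mulrC !cReMNi.
Qed.

(** * The transform of the dilation-and-modulation system *)

Local Notation E m x :=
  (((Num.sqrt (a - 1))^-1)%:C * expiR (2 * pi * m%:~R * x / (a - 1)) : R[i]).

Let subr1_gt0 : 0 < a - 1. Proof. by rewrite subr_gt0. Qed.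

Let measurable_E (D : set mR) m : cmeasurable_fun D (fun x => E m x).
Proof.
apply: cmeasurableM; first exact: cmeasurable_cst.
apply: cmeasurable_expiR; apply: measurable_funTS.
by apply: measurable_funM => //; exact: mulrl_measurable.
Qed.

Lemma Lambda_scale m k x : J x -> Lambda a m (a ^ k * x) = E m x.
Proof.
rewrite /= in_itv/= => Jx; rewrite /Lambda /dilation_periodize -/(level a _) levelM//.
by rewrite [a ^ k * x]mulrC mulfK// gt_eqF// expaz_gt0.
Qed.

Lemma cmeasurable_Lambda m : cmeasurable_fun Rp (Lambda a m).
Proof.
have mN k := @measurable_level R a a1 k.
have H k : cmeasurable_fun Rp (fun x => E m (x / a ^ k)).
  have [h1 h2] := measurable_E setT m.
  by split; apply: measurable_funTS;
    [apply: (measurableT_comp h1)|apply: (measurableT_comp h2)]; exact: measurable_funM.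
split.
  apply: (measurable_select mRp mN (f := fun k x => complex.Re (E m (x / a ^ k)))) => k.
  exact: (H k).1.
apply: (measurable_select mRp mN (f := fun k x => complex.Im (E m (x / a ^ k)))) => k.
exact: (H k).2.
Qed.

Local Notation atom g m j := (fun x => Lambda a m x * dilation (a ^ j) g x).

Lemma sqrt_expz j : Num.sqrt (a ^ j) = a `^ (j%:~R / 2).
Proof. by rewrite -(powRa_sqr a1) sqrtr_sqr ger0_norm// powR_ge0. Qed.

(** Lambda_m takes the same value at x and a^k x, so it factors out of the
    sequence; the dilation by a^j shifts the index by j. *)
Lemma dilation_coef_atom g m j k x : J x ->
  dilation_coef a (atom g m j) x k = E m x * dilation_coef a g x (k + j).
Proof.
move=> Jx; rewrite /dilation_coef/= Lambda_scale// /dilation sqrt_expz.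
have -> : (a `^ ((k + j)%:~R / 2))%:C = (a `^ (k%:~R / 2))%:C * (a `^ (j%:~R / 2))%:C :> R[i].
  rewrite intrD mulrDl powRD ?(gt_eqF a0) ?implybT// rmorphM//.
have -> : a ^ j * (a ^ k * x) = a ^ (k + j) * x.
  by rewrite expfzDr ?gt_eqF// mulrA [a ^ j * _]mulrC.
by ring.
Qed.

Lemma cmeasurable_atom g m j : cmeasurable_fun Rp g -> cmeasurable_fun Rp (atom g m j).
Proof.
move=> mg; apply: cmeasurableM; first exact: cmeasurable_Lambda.
apply: cmeasurableM; first exact: cmeasurable_cst.
exact: cmeasurable_scale.
Qed.

(** A shift of the coefficients by j is multiplication of the slice by
    char (- j). *)
Lemma Zak_atom g P m j : is_Zak g P ->
  is_Zak (atom g m j) (fun p => E m p.1 * char (- j) p.2 * P p).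
Proof.
move=> [mP gP]; split.
  apply: cmeasurableM => //; apply: cmeasurableM.
    by apply: (cmeasurable_fst I mJ (h := fun x => E m x)); exact: measurable_E.
  by apply: (cmeasurable_snd J measurableI01 (h := char (- j))); exact: measurable_char.
apply: ae_imply gP => x h Jx; have [iP cP] := h Jx; split.
  have i1 : cintegrable mu I (fun xi => P (x, xi) * (char j xi)^*).
    exact: cintegrable_charJ.
  have i2 : cintegrable mu I (fun xi => E m x * (P (x, xi) * (char j xi)^*)).
    exact: cintegrableZ.
  apply: (eq_cintegrable _ _ i2) => // xi _ /=.
  by rewrite charN; ring.
move=> k; rewrite dilation_coef_atom// -cP /fcoef -cintegralZ//; last exact: cintegrable_charJ.
by apply: eq_cintegral => xi _ /=; rewrite charN charD rmorphM/=; ring.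
Qed.

Lemma inL2_atom g P m j : inL2 Rp g -> is_Zak g P -> inL2 Rp (atom g m j).
Proof.
move=> [mg gi] ZP; have mA := cmeasurable_atom m j mg; split => //.
have [mP _] := ZP.
change (sqnorm2 mu Rp (atom g m j) < +oo)%E.
rewrite (Zak_isometry mA (Zak_atom m j ZP)).
have -> : sqnorm2 leb Q (fun p => E m p.1 * char (- j) p.2 * P p) =
    sqnorm2 leb Q (fun p => ((Num.sqrt (a - 1))^-1)%:C * P p).
  apply: eq_integral => p _; congr EFin.
  by rewrite !sqnormcM sqnormc_char sqnormc_expiR !mulr1.
rewrite (sqnorm2Z leb mQ)// -(Zak_isometry mg ZP).
by apply: lte_mul_pinfty => //; rewrite lee_fin sqnormc_ge0.
Qed.

(** The inner products are the coefficients of F conj(P) for the orthonormal basis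
    of [parseval_strip], with j replaced by -j. *)
Lemma frame_sum f g F P : inL2 Rp f -> inL2 Rp g -> is_Zak f F -> is_Zak g P ->
  (\esum_(mj in [set: int * int])
     (sqnormc (innerL2 Rp f (atom g mj.1 mj.2)))%:E)%E =
  sqnorm2 leb Q (fun p => F p * (P p)^*).
Proof.
move=> Lf Lg ZF ZP; have [mf fi] := Lf; have [mg gi] := Lg.
have [mF _] := ZF; have [mP _] := ZP.
have Fi : (sqnorm2 leb Q F < +oo)%E by rewrite -(Zak_isometry mf ZF); exact: fi.
have Pi : (sqnorm2 leb Q P < +oo)%E by rewrite -(Zak_isometry mg ZP); exact: gi.
have iH := cintegrable_mul2 mQ mF mP Fi Pi.
have := @parseval_strip R (a - 1) 1 subr1_gt0; rewrite (_ : 1 + (a - 1) = a); last by ring.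
move=> /(_ _ iH) <-.
rewrite (@reindex_esum _ _ _ [set: int * int] setT (fun p => (p.1, - p.2))); last first.
  split => //.
    by move=> [x y] [x' y'] _ _ [-> /oppr_inj ->].
  by move=> [x y] _; exists (x, - y) => //=; rewrite opprK.
apply: eq_esum => -[m j] _ /=; congr (sqnormc _)%:E.
rewrite (Zak_inner Lf (inL2_atom m (- j) Lg ZP) ZF (Zak_atom m (- j) ZP)).
apply: eq_cintegral => p _.
by rewrite opprK !rmorphM/=; ring.
Qed.

(** * Existence of the Theta transform *)

Lemma energy_dilation_coef f j x :
  energy (dilation_coef a f x) = ((a ^ j)%:E * energy (dilation_coef a f (a ^ j * x)))%E.
Proof.
rewrite -(energy_shift (dilation_coef a f (a ^ j * x)) j); apply: energyZ => k.
rewrite !(sqnormc_dilation_coef a1).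
have -> : a ^ (k - j) * (a ^ j * x) = a ^ k * x by rewrite mulrA -expfzDr ?gt_eqF// subrK.
by rewrite [RHS]mulrA -expfzDr ?gt_eqF// addrC subrK.
Qed.

(** On [1, a) the energy is integrable, with integral the squared norm of f. At
    other points it is a power of a times the energy at the representative in
    [1, a), and null sets are preserved by dilations. *)
Lemma ae_energy_lty f : inL2 Rp f ->
  {ae mu, forall x, Rp x -> (energy (dilation_coef a f x) < +oo)%E}.
Proof.
move=> [mf fi]; have {}fi : (sqnorm2 mu Rp f < +oo)%E := fi.
rewrite (sqnorm2_Rpos a1 mf) in fi.
have aeJ : {ae mu, forall x, J x -> (energy (dilation_coef a f x) < +oo)%E}.
  have iE : mu.-integrable J (fun x => energy (dilation_coef a f x)).
    apply/integrableP; split.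
      apply: measurable_esum_int => //; last by move=> k x _; rewrite lee_fin sqnormc_ge0.
      move=> k; apply/measurable_EFinP/measurable_sqnormc.
      exact: (cmeasurable_funS mRp JRp (measurable_dilation_coef a1 k mf)).
    rewrite -(@eq_integral _ _ _ mu J _ (fun x => energy (dilation_coef a f x)))//.
    by move=> x _; rewrite gee0_abs// energy_ge0.
  apply: ae_imply (integrable_ae mJ iE) => x h Jx.
  by rewrite -ge0_fin_numE ?energy_ge0//; exact: h.
have aeA k : {ae mu, forall x, J (a ^ k * x) ->
    (energy (dilation_coef a f (a ^ k * x)) < +oo)%E}.
  apply: ae_imply (ae_affine 0 (expaz_gt0 a1 k) aeJ) => x.
  by rewrite add0r.
apply: ae_imply (ae_forall_int aeA) => x h Rx.
have x0 : 0 < x by move: Rx; rewrite /Rpos/= in_itv/= andbT.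
rewrite (energy_dilation_coef f (- level a x)) lte_mul_pinfty ?lee_fin ?(ltW (expaz_gt0 a1 _))//.
apply: h; rewrite /= in_itv/=.
have /eqP := erefl (level a x); rewrite -(levelE a1 _ x0) => /andP[h1 h2].
rewrite -invr_expz mulrC ler_pdivlMr ?expaz_gt0// mul1r h1/=.
by rewrite ltr_pdivrMr ?expaz_gt0// mulrC -[X in _ * X]expr1z -expfzDr ?gt_eqF.
Qed.

Lemma Theta_psumE f n x xi :
  Theta_psum a f n x xi = tpoly (zrange n) (dilation_coef a f x) xi.
Proof. exact: (big_zrange (fun l => Theta_term a f x xi l)). Qed.

Lemma Theta_exists f : inL2 Rp f ->
  is_Theta a f (fun p => fsum (dilation_coef a f p.1) p.2).
Proof.
move=> Lf; have [mf _] := Lf; split.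
- apply: (measurable_fsum_joint mRp) => k; exact: (measurable_dilation_coef a1 k mf).
- apply: ae_imply (ae_energy_lty Lf) => x h Rx.
  have := cvg_fsum (h Rx).
  rewrite (_ : (fun n => sqnormL2 _ _) = (fun n => sqnorm2 mu I (fun t => tpoly (zrange n) (dilation_coef a f x) t - fsum (dilation_coef a f x) t)))//.
  by apply/funext => n; apply: eq_integral => xi _; rewrite Theta_psumE.
- by apply: aeW => p _ /=; exact: fsumD1.
Qed.

Lemma Theta_spec f : inL2 Rp f -> is_Theta a f (Theta a f).
Proof. by move=> Lf; apply: xgetPex; exists (fun p => fsum (dilation_coef a f p.1) p.2); exact: Theta_exists. Qed.

Lemma cmeasurable_section F x : cmeasurable_fun Q F -> J x ->
  cmeasurable_fun I (fun xi => F (x, xi)).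
Proof.
have mp : measurable_fun I (fun xi : mR => (x, xi) : plane R) by apply: measurable_funTS; exact: pair1_measurable.
move=> [h1 h2] Jx; have pQ : (fun xi : mR => (x, xi) : plane R) @` I `<=` Q by move=> _ [xi Ixi <-].
by split; [exact: (measurable_comp mQ pQ h1 mp)|exact: (measurable_comp mQ pQ h2 mp)].
Qed.

(** Mean square convergence of the partial sums identifies the Fourier
    coefficients of the slice. *)
Lemma Theta_Zak f F : is_Theta a f F -> is_Zak f F.
Proof.
move=> [mF cF _].
have {}mF : cmeasurable_fun Q F.
  apply: (cmeasurable_funS _ _ mF); first exact: measurableX.
  by move=> p [Jp _]; split => //; exact: JRp.
split => //; apply: ae_imply cF => x h Jx.
have mFx := cmeasurable_section mF Jx.
have [||i c] := @fcoef_of_cvg R (dilation_coef a f x) (fun xi => F (x, xi)) => //.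
  have := h (JRp Jx).
  rewrite (_ : (fun n => sqnormL2 _ _) = (fun n => sqnorm2 mu I (fun t => tpoly (zrange n) (dilation_coef a f x) t - F (x, t))))//.
  by apply/funext => n; apply: eq_integral => xi _; rewrite Theta_psumE.
by split => //; exact: cintegrable01_sq.
Qed.

(** * Surjectivity of the transform *)

Lemma leb2_strip_lty : (leb Q < +oo)%E.
Proof.
have -> : leb Q = (mu J * mu I)%E by exact: product_measure1E.
rewrite [X in (_ * X)%E]measure01 mule1.
by rewrite lebesgue_measure_itv/= lte_fin a1 -EFinB ltry.
Qed.

(** Put f (a^k x) = a^(-k/2) times the k-th coefficient of G (x, .) for x in [1, a);
    the norm of f is finite because the transform is isometric. *)
Lemma Zak_surjective G : cmeasurable_fun Q G -> (sqnorm2 leb Q G < +oo)%E ->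
  exists2 f, inL2 Rp f & is_Zak f G.
Proof.
move=> mG Gi.
have m1 : cmeasurable_fun Q (fun=> (1%R : R[i])) by exact: cmeasurable_cst.
have i1 : (sqnorm2 leb Q (fun=> (1%R : R[i])) < +oo)%E.
  have -> : sqnorm2 leb Q (fun=> (1%R : R[i])) = (\int[leb]_(x in Q) 1)%E.
    by apply: eq_integral => p _; rewrite sqnormcE/= expr1n expr0n addr0.
  by rewrite integral_cst// mul1e leb2_strip_lty.
have iG : cintegrable leb Q G.
  apply: (eq_cintegrable mQ _ (cintegrable_mul2 mQ mG m1 Gi i1)) => p _.
  by rewrite rmorph1 mulr1.
have [aeG _ _] := cfubini_rect mJ measurableI01 iG.
have mc k : cmeasurable_fun J (fun x => fcoef (fun xi => G (x, xi)) k).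
  have iH : cintegrable leb Q (fun p => G p * (char k p.2)^*).
    apply: (@cintegrableM_bounded _ _ _ leb Q mQ G _ 1) => //.
      apply: (cmeasurable_snd J measurableI01 (h := fun t => (char k t)^*)).
      exact/cmeasurableJ/measurable_char.
    by move=> p _; rewrite sqnormcJ sqnormc_char.
  by have [_ /cintegrable_measurable + _] := cfubini_rect mJ measurableI01 iH.
(* coefficients extended by zero off [1, a), so that each one is measurable
   on the whole line before the level of the point selects which to use *)
pose cR k := (fun x => complex.Re (fcoef (fun xi => G (x, xi)) k)) \_ J.
pose cI k := (fun x => complex.Im (fcoef (fun xi => G (x, xi)) k)) \_ J.
have mcR k : measurable_fun [set: mR] (cR k) by exact: ((measurable_restrictT _ mJ).1 (mc k).1).
have mcI k : measurable_fun [set: mR] (cI k) by exact: ((measurable_restrictT _ mJ).1 (mc k).2).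
pose g k y := (a `^ (- (k%:~R / 2)))%:C * (cR k (y / a ^ k) +i* cI k (y / a ^ k)).
have mg k : cmeasurable_fun Rp (g k).
  apply: cmeasurableM; first exact: cmeasurable_cst.
  split; apply: measurable_funTS.
    by apply: (measurableT_comp (mcR k)); exact: measurable_funM.
  by apply: (measurableT_comp (mcI k)); exact: measurable_funM.
pose f y := g (level a y) y.
have mf : cmeasurable_fun Rp f.
  have mN k := @measurable_level R a a1 k.
  split.
    exact: (measurable_select mRp mN (f := fun k y => complex.Re (g k y)) (fun k => (mg k).1)).
  exact: (measurable_select mRp mN (f := fun k y => complex.Im (g k y)) (fun k => (mg k).2)).
have ZG : is_Zak f G.
  split => //; apply: ae_imply aeG => x h Jx; split; first exact: h.
  have Jx' : 1 <= x < a by move: Jx; rewrite /= in_itv.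
  move=> k; rewrite /dilation_coef /f levelM//.
  rewrite /g [a ^ k * x]mulrC mulfK ?gt_eqF ?expaz_gt0// /cR /cI /patch mem_set//.
  rewrite mulrA -rmorphM -powRD ?(gt_eqF a0) ?implybT// subrr powRr0 rmorph1 mul1r.
  exact: eq_complexP.
exists f => //; split => //.
by change (sqnorm2 mu Rp f < +oo)%E; rewrite (Zak_isometry mf ZG).
Qed.

(** * Frame bounds *)

Section frame_bounds.
Variables (L : nat) (psi : 'I_L -> R -> R[i]).
Hypothesis psi_L2 : forall l, inL2 Rp (psi l).

Definition Theta_sqsum (p : plane R) : R := \sum_(l < L) sqnormc (Theta a (psi l) p).

Lemma Theta_sqsum_ge0 p : 0 <= Theta_sqsum p.
Proof. by apply: sumr_ge0 => l _; exact: sqnormc_ge0. Qed.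

Let ZP l : is_Zak (psi l) (Theta a (psi l)).
Proof. exact/Theta_Zak/Theta_spec. Qed.

Lemma measurable_Theta_sqsum : measurable_fun Q Theta_sqsum.
Proof. by apply: measurable_sum => l; apply: measurable_sqnormc; exact: (ZP l).1. Qed.

Lemma total_frame_sum f F : inL2 Rp f -> is_Zak f F ->
  (\sum_(l < L) \esum_(mj in [set: int * int])
     (sqnormc (innerL2 Rp f (MD psi a l mj.1 mj.2)))%:E =
   \int[leb]_(p in Q) (sqnormc (F p) * Theta_sqsum p)%:E)%E.
Proof.
move=> Lf ZF; have [mF _] := ZF.
transitivity (\sum_(l < L) sqnorm2 leb Q (fun p => (F p * (Theta a (psi l) p)^*)%R))%E.
  by apply: eq_bigr => l _; exact: (frame_sum Lf (psi_L2 l) ZF (ZP l)).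
rewrite /sqnorm2 -ge0_integral_sum//; last 2 first.
- move=> l; apply/measurable_EFinP/measurable_sqnormc/cmeasurableM => //.
  exact/cmeasurableJ/(ZP l).1.
- by move=> l p _; rewrite lee_fin sqnormc_ge0.
apply: eq_integral => p _; rewrite sumEFin /Theta_sqsum mulr_sumr; congr EFin.
by apply: eq_bigr => l _; rewrite sqnormcM sqnormcJ.
Qed.

(** Multiply the bounds by |Theta f|^2 and integrate. *)
Lemma frame_of_bounds A B : 0 <= A -> A <= B ->
  {ae leb, forall p, Q p -> A <= Theta_sqsum p <= B} -> is_MD_frame psi a A B.
Proof.
move=> A0 AB AWB f Lf S; have [mf _] := Lf.
have ZF : is_Zak f (Theta a f) by exact/Theta_Zak/Theta_spec.
have [mF _] := ZF.
have -> : S = (\int[leb]_(p in Q) (sqnormc (Theta a f p) * Theta_sqsum p)%:E)%E.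
  exact: total_frame_sum.
have -> : sqnormL2 (@Rpos R) f = sqnorm2 leb Q (Theta a f) by exact: Zak_isometry.
have ms : measurable_fun Q (fun p => sqnormc (Theta a f p)) by exact: measurable_sqnormc.
have mW := measurable_Theta_sqsum.
have mcs (c : R) : measurable_fun Q (fun p => (c * sqnormc (Theta a f p))%:E).
  by apply/measurable_EFinP; exact: measurable_funM.
have msW : measurable_fun Q (fun p => (sqnormc (Theta a f p) * Theta_sqsum p)%:E).
  by apply/measurable_EFinP; exact: measurable_funM.
have scale (c : R) : 0 <= c -> (c%:E * sqnorm2 leb Q (Theta a f) =
    \int[leb]_(p in Q) (c * sqnormc (Theta a f p))%:E)%E.
  move=> c0; rewrite /sqnorm2 -ge0_integralZl//; first exact/measurable_EFinP.
  by move=> p _; rewrite lee_fin sqnormc_ge0.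
have B0 : 0 <= B by exact: le_trans AB.
rewrite !scale//; split; apply: ae_ge0_le_integral => //.
- by move=> p _; rewrite lee_fin mulr_ge0// sqnormc_ge0.
- by move=> p _; rewrite lee_fin mulr_ge0 ?sqnormc_ge0 ?Theta_sqsum_ge0.
- apply: ae_imply AWB => p h Qp; have /andP[h1 _] := h Qp.
  by rewrite lee_fin mulrC ler_wpM2l ?sqnormc_ge0.
- by move=> p _; rewrite lee_fin mulr_ge0 ?sqnormc_ge0 ?Theta_sqsum_ge0.
- by move=> p _; rewrite lee_fin mulr_ge0// sqnormc_ge0.
- apply: ae_imply AWB => p h Qp; have /andP[_ h2] := h Qp.
  by rewrite lee_fin mulrC ler_wpM2r ?sqnormc_ge0.
Qed.

(** The indicator of E is square integrable on Q, hence the transform of some f,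
    whose squared norm is the measure of E. *)
Lemma frame_on_indicator A B (E : set (plane R)) : is_MD_frame psi a A B ->
  measurable E -> E `<=` Q ->
  (A%:E * leb E <= \int[leb]_(p in E) (Theta_sqsum p)%:E)%E /\
  (\int[leb]_(p in E) (Theta_sqsum p)%:E <= B%:E * leb E)%E.
Proof.
move=> frame mE EQ.
pose G p : R[i] := ((\1_E p) : R)%:C.
have sG p : sqnormc (G p) = \1_E p.
  by rewrite sqnormcC indicE; case: (p \in E) => /=; rewrite ?expr1n ?expr0n.
have mG : cmeasurable_fun Q G.
  by apply: cmeasurable_real; apply: measurable_funTS; exact: measurable_indic.
have nG : sqnorm2 leb Q G = leb E.
  transitivity (\int[leb]_(p in Q) (\1_E p)%:E)%E.
    by apply: eq_integral => p _; rewrite sG.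
  by rewrite integral_indic// setIidl.
have EQlty : (leb E < +oo)%E.
  by apply: le_lt_trans leb2_strip_lty; apply: le_measure => //; rewrite inE.
have [f Lf ZG] : exists2 f, inL2 Rp f & is_Zak f G.
  by apply: (Zak_surjective mG); rewrite nG.
have := frame f Lf; rewrite /= (total_frame_sum Lf ZG).
have [mf _] := Lf.
have -> : sqnormL2 (@Rpos R) f = leb E by rewrite -nG; exact: Zak_isometry.
rewrite (_ : (\int[leb]_(p in Q) _)%E = (\int[leb]_(p in E) (Theta_sqsum p)%:E)%E)//.
transitivity (\int[leb]_(p in Q) ((fun p => (Theta_sqsum p)%:E) \_ E) p)%E.
  apply: eq_integral => p _; rewrite sG indicE /patch; case: ifP => _ /=.
    by rewrite mul1r.
  by rewrite mul0r.
by rewrite -integral_mkcondr setIidr.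
Qed.

(** On E = {W < A} the frame inequality gives A |E| <= int_E W although W < A
    there, so E is null; symmetrically for {W > B}. The measure of Q is finite,
    so the integrals compared are finite. *)
Lemma bounds_of_frame A B : 0 <= A -> 0 <= B -> is_MD_frame psi a A B ->
  {ae leb, forall p, Q p -> A <= Theta_sqsum p <= B}.
Proof.
move=> A0 B0 frame; have mW := measurable_Theta_sqsum.
have mlt (u v : plane R -> R) : measurable_fun Q u -> measurable_fun Q v ->
    measurable (Q `&` [set x | v x < u x]).
  by move=> mu mv; have := measurable_fun_ltr mv mu mQ (Y := [set true]); apply.
have fin (E : set (plane R)) : E `<=` Q -> measurable E -> (leb E < +oo)%E.
  by move=> EQ mE; apply: le_lt_trans leb2_strip_lty; apply: le_measure => //; rewrite inE.
have cstE (c : R) (E : set (plane R)) : measurable E -> (\int[leb]_(p in E) c%:E = c%:E * leb E)%E.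
  by move=> mE; rewrite integral_cst.
have subQ (E : set (plane R)) : Q `&` E `<=` Q by move=> p [].
have lo : {ae leb, forall p, Q p -> A <= Theta_sqsum p}.
  have mE := mlt (cst A) Theta_sqsum (measurable_cst _) mW.
  have [h _] := frame_on_indicator frame mE (@subQ _).
  apply: ae_le_of_integral => //.

  - by move=> p _; exact: Theta_sqsum_ge0.
  - apply: (@le_lt_trans _ _ (\int[leb]_(p in Q `&` [set x | (Theta_sqsum x < A)%R]) A%:E)%E).
      apply: ge0_le_integral => //.
      + by move=> p _; rewrite lee_fin Theta_sqsum_ge0.
      + by apply/measurable_EFinP; apply: measurable_funS mW.
      + by move=> p [_ /= /ltW]; rewrite lee_fin.
    by rewrite cstE// lte_mul_pinfty// fin.
  - by rewrite cstE.
have hi : {ae leb, forall p, Q p -> Theta_sqsum p <= B}.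
  have mE := mlt Theta_sqsum (cst B) mW (measurable_cst _).
  have [_ h] := frame_on_indicator frame mE (@subQ _).
  apply: ae_le_of_integral => //.

  - by rewrite cstE// lte_mul_pinfty// fin.
  - by rewrite cstE.
by apply: ae_imply2 lo hi => p h1 h2 Qp; rewrite h1// h2.
Qed.

End frame_bounds.
End zak.

Theorem theorem2p3 (R : realType) (a : R) (L : nat)
    (psi : 'I_L -> R -> R[i]) (A B : R)
    (a_gt1 : 1 < a)
    (psi_L2 : forall l : 'I_L, inL2 (@Rpos R) (psi l))
    (psi_distinct : forall l l' : 'I_L, l <> l' ->
       ~ eqL2 (@Rpos R) (psi l) (psi l'))
    (A_gt0 : 0 < A) (A_leB : A <= B) :
  is_MD_frame psi a A B <->
  {ae @leb2 R, forall p : plane R, (`[1, a[ `*` `[0, 1[) p ->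
     A <= \sum_(l < L) sqnormc (Theta a (psi l) p) <= B}.
Proof.
have A0 : 0 <= A by exact: ltW.
split => [frame|bounds].
  exact: (bounds_of_frame a_gt1 psi_L2 A0 (le_trans A0 A_leB) frame).
exact: (frame_of_bounds a_gt1 psi_L2 A0 A_leB bounds).
Qed.
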